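(* Assume that $V$ is self-adjoint with $|V(x)|\lesssim\langle x\rangle^{-\beta}$ for some $\beta>2$. Let $\phi\in S_1L^2$ and let $\psi=-\mathcal G_{0,0}v^*\phi$, so that $\phi=Uv\psi$. Then $$\psi(x)=\frac{-i\alpha\cdot x}{2\pi\langle x\rangle^2}\,\mathcal G_{1,1}v^*\phi+\Gamma_2(x),$$ where $\Gamma_2\in L^2\cap L^\infty$.
   Context: Functions are $\mathbb C^2$-valued on $\mathbb R^2$ and $L^p$ means $L^p(\mathbb R^2;\mathbb C^2)$. $\alpha\cdot x=\alpha_1x_1+\alpha_2x_2$ with $\alpha_1=\begin{pmatrix}0&1\\1&0\end{pmatrix}$, $\alpha_2=\begin{pmatrix}0&-i\\ i&0\end{pmatrix}$; $V:\mathbb R^2\to\mathbb C^{2\times2}$ is Hermitian matrix valued. $\langle x\rangle=(1+|x|^2)^{1/2}$, and $|V(x)|\lesssim\langle x\rangle^{-\beta}$ means every entry satisfies this bound with some constant. Diagonalize $V=B^*\,\mathrm{diag}(\zeta_1,\zeta_2)B$ pointwise with $B(x)$ unitary, $\zeta_j(x)\in\mathbb R$; put $\eta_j=|\zeta_j|^{1/2}$, $v=\mathrm{diag}(\eta_1,\eta_2)B$, $U=\mathrm{diag}(\mathrm{sign}\,\zeta_1,\mathrm{sign}\,\zeta_2)$ (with $\mathrm{sign}\,0:=1$), so $V=v^*Uv$. $\mathcal G_{0,0}$ is the integral operator with kernel $\frac{i\alpha\cdot(x-y)}{2\pi|x-y|^2}$; $\mathcal G_{1,1}$ is the integral operator with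 kernel $1$ (times the identity matrix), so $\mathcal G_{1,1}f=\int_{\mathbb R^2}f(y)\,dy\in\mathbb C^2$. $T=U+v\mathcal G_{0,0}v^*$ on $L^2$, and $S_1$ is the Riesz projection onto $\ker T$. *)

(* Defs.v *)
From HB Require Import structures.
From mathcomp Require Import all_boot all_order all_algebra.
From mathcomp Require Import sesquilinear spectral.
From mathcomp.real_closed Require Import complex.
From mathcomp Require Import all_classical all_reals all_analysis.
Set Implicit Arguments.
Unset Strict Implicit.
Unset Printing Implicit Defensive.
Import Order.TTheory GRing.Theory Num.Theory.
Import numFieldNormedType.Exports.

Local Open Scope classical_set_scope.
Local Open Scope sesquilinear_scope.
Local Open Scope complex_scope.
Local Open Scope ring_scope.

Notation plane R := (measurableTypeR R * measurableTypeR R)%type.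

Section Dirac2D.
Context {R : realType}.
Local Notation plane := (plane R).

Definition leb2 : {measure set plane -> \bar R} :=
  (@lebesgue_measure R \x @lebesgue_measure R)%E.

(* The library norm on a product type is the sup norm; [enorm2] is the
   Euclidean one. *)
Definition enorm2 (x : plane) : R := Num.sqrt (x.1 ^+ 2 + x.2 ^+ 2).
Definition japanese (x : plane) : R := Num.sqrt (1 + enorm2 x ^+ 2).

Definition mx2 (a b c d : R[i]) : 'M[R[i]]_2 :=
  \matrix_(i < 2, j < 2)
    if i == 0 then (if j == 0 then a else b) else (if j == 0 then c else d).
Definition alpha1 : 'M[R[i]]_2 := mx2 0 1 1 0.
Definition alpha2 : 'M[R[i]]_2 := mx2 0 (- 'i) 'i 0.
Definition alpha_dot (x : plane) : 'M[R[i]]_2 :=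
  (x.1 : R)%:C *: alpha1 + (x.2 : R)%:C *: alpha2.

Definition spinor_field : Type := plane -> 'cV[R[i]]_2.
Definition matrix_field : Type := plane -> 'M[R[i]]_2.

Definition complex_measurable (g : plane -> R[i]) : Prop :=
  measurable_fun setT (fun x => complex.Re (g x) : R) /\
  measurable_fun setT (fun x => complex.Im (g x) : R).
Definition mx_measurable m n (F : plane -> 'M[R[i]]_(m, n)) : Prop :=
  forall i j, complex_measurable (fun x => F x i j).

Definition spinor_norm (a : 'cV[R[i]]_2) : R :=
  Num.sqrt (\sum_(i < 2) ComplexField.Normc.normc (a i 0) ^+ 2).
Definition LpNorm (p : \bar R) (f : spinor_field) : \bar R :=
  ('N[leb2]_p[(fun x => (spinor_norm (f x))%:E)])%E.
Definition in_Lp (p : \bar R) (f : spinor_field) : Prop :=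
  mx_measurable f /\ finite_norm leb2 p (fun x => spinor_norm (f x)).

Definition complex_integral d (T : measurableType d)
    (mu : {measure set T -> \bar R}) (D : set T) (g : T -> R[i]) : R[i] :=
  Rintegral mu D (fun x => complex.Re (g x)) +i*
  Rintegral mu D (fun x => complex.Im (g x)).
Definition spinor_integral (f : spinor_field) : 'cV[R[i]]_2 :=
  \col_i complex_integral leb2 setT (fun x => f x i 0).
Definition inner_L2 (f g : spinor_field) : R[i] :=
  complex_integral leb2 setT (fun x => \sum_(i < 2) f x i 0 * (g x i 0)^*).

Definition kernel_operator (K : plane -> matrix_field) (f : spinor_field) :
  spinor_field := fun x => spinor_integral (fun y => K x y *m f y).

Definition G00_kernel (x y : plane) : 'M[R[i]]_2 :=
  ('i / (2 * pi * enorm2 (x - y) ^+ 2)%:C) *: alpha_dot (x - y).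
Definition G00 : spinor_field -> spinor_field := kernel_operator G00_kernel.
Definition G11 : spinor_field -> spinor_field :=
  kernel_operator (fun _ _ => 1%:M).

Definition decays (beta : R) (V : matrix_field) : Prop :=
  exists C : R, forall x (i j : 'I_2),
    ComplexField.Normc.normc (V x i j) <= C * japanese x `^ (- beta).

Definition diagonalizes (V B : matrix_field) (zeta : 'I_2 -> plane -> R) :
    Prop :=
  [/\ mx_measurable B, forall j, measurable_fun setT (zeta j : plane -> R),
      forall x, B x \is unitarymx &
      forall x, V x = (B x)^t* *m diag_mx (\row_j (zeta j x)%:C) *m B x].

Definition v_of (B : matrix_field) (zeta : 'I_2 -> plane -> R) : matrix_field :=
  fun x => diag_mx (\row_j (Num.sqrt `|zeta j x|)%:C) *m B x.
Definition U_of (zeta : 'I_2 -> plane -> R) : matrix_field :=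
  fun x => diag_mx (\row_j (if zeta j x < 0 then -1 else 1)).

Definition mult (M : matrix_field) (f : spinor_field) : spinor_field :=
  fun x => M x *m f x.
Definition mult_adj (M : matrix_field) (f : spinor_field) : spinor_field :=
  fun x => (M x)^t* *m f x.

Definition T_of (B : matrix_field) (zeta : 'I_2 -> plane -> R)
    (f : spinor_field) : spinor_field := fun x =>
  mult (U_of zeta) f x + mult (v_of B zeta) (G00 (mult_adj (v_of B zeta) f)) x.

(* Elements of L^2 are represented by functions, so operators on L^2 are maps
   on representatives whose identities hold almost everywhere.  Compatibility
   with a.e. equality follows from linearity and boundedness. *)
Definition ae_same (f g : spinor_field) : Prop := f = g %[ae leb2].

Definition bounded_L2_operator (A : spinor_field -> spinor_field) : Prop :=
  [/\ forall f, in_Lp 2%:E f -> in_Lp 2%:E (A f),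
      forall (a : R[i]) f g, in_Lp 2%:E f -> in_Lp 2%:E g ->
        ae_same (A (fun x => a *: f x + g x)) (fun x => a *: A f x + A g x) &
      exists C : R, forall f, in_Lp 2%:E f ->
        (LpNorm 2%:E (A f) <= C%:E * LpNorm 2%:E f)%E].

(* Q = (z - A)^-1 on L^2. *)
Definition is_resolvent (A : spinor_field -> spinor_field) (z : R[i])
    (Q : spinor_field -> spinor_field) : Prop :=
  [/\ bounded_L2_operator Q,
      forall f, in_Lp 2%:E f -> ae_same (fun x => z *: Q f x - A (Q f) x) f &
      forall f, in_Lp 2%:E f -> ae_same (Q (fun x => z *: f x - A f x)) f].

(* The integral of F(z) dz over the positively oriented circle |z - c| = r. *)
Definition circle_integral (c : R[i]) (r : R) (F : R[i] -> R[i]) : R[i] :=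
  complex_integral (@lebesgue_measure R) `[0, 2 * pi] (fun t =>
    let e := r%:C * (cos t +i* sin t) in F (c + e) * ('i * e)).

(* P = (2 pi i)^-1 \oint_{|z - c| = r} (z - A)^-1 dz as a weak integral, where
   the closed disc of radius r around c meets the spectrum of A at most in c. *)
Definition is_Riesz_projection (A : spinor_field -> spinor_field) (c : R[i])
    (P : spinor_field -> spinor_field) : Prop :=
  bounded_L2_operator P /\
  exists (r : R) (Q : R[i] -> spinor_field -> spinor_field),
    [/\ 0 < r,
        forall z, 0 < ComplexField.Normc.normc (z - c) <= r ->
          is_resolvent A z (Q z) &
        forall f g, in_Lp 2%:E f -> in_Lp 2%:E g ->
          inner_L2 (P f) g =
          (2 * pi%:C * 'i)^-1 *
          circle_integral c r (fun z => inner_L2 (Q z f) g)].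

Definition in_range (P : spinor_field -> spinor_field) (phi : spinor_field) :
    Prop :=
  in_Lp 2%:E phi /\ exists2 f, in_Lp 2%:E f & ae_same phi (P f).
Definition in_ker (A : spinor_field -> spinor_field) (phi : spinor_field) :
    Prop :=
  in_Lp 2%:E phi /\ ae_same (A phi) (fun=> 0).

Definition is_Riesz_projection_onto_ker (A P : spinor_field -> spinor_field) :
    Prop :=
  is_Riesz_projection A 0 P /\ forall phi, in_range P phi <-> in_ker A phi.

End Dirac2D.

Arguments spinor_field : clear implicits.
Arguments matrix_field : clear implicits.

(* Main.v *)
From HB Require Import structures.
Require Import Defs.
From mathcomp Require Import all_boot all_order all_algebra.
From mathcomp Require Import sesquilinear spectral.
From mathcomp.real_closed Require Import complex.
From mathcomp Require Import all_classical all_reals all_analysis.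
From mathcomp Require Import measurable_realfun ess_sup_inf.
From mathcomp Require Import ring lra.
Set Implicit Arguments.
Unset Strict Implicit.
Unset Printing Implicit Defensive.
Import Order.TTheory GRing.Theory Num.Theory.
Import numFieldNormedType.Exports.
Local Open Scope classical_set_scope.
Local Open Scope sesquilinear_scope.
Local Open Scope complex_scope.
Local Open Scope ring_scope.

(** The density h = v^* phi satisfies psi = - G00 h, and the kernel of G00 is
    bounded by 1 / |x - y|.  Since phi lies in the kernel of T, U phi = v psi
    almost everywhere; as U is an involution this is phi = U v psi, and hence
    h = v^* U v psi = V psi: the density is psi times a decaying matrix.  The
    remainder is then controlled by a bootstrap, carried out with pointwise
    bounds instead of the Lebesgue scale.

    - The entries of v are O(<y>^(-beta/2)), which is square integrable because
      beta > 2, so phi in L^2 puts h in L^1 and in L^2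
      ([density_integrals]).
    - The potential of |h| for the kernel 1 / |x - y| is bounded
      ([potential_bounded]).  The kernel misses local square integrability
      only by a logarithm, so h in L^2 alone is not enough; but |h| is itself
      at most a constant times its own potential, and substituting that once
      replaces the kernel by its iterate, whose singularity is logarithmic.
    - Therefore psi is bounded and |h(y)| = O(<y>^(-beta)).
    - Subtracting the leading term from psi = - G00 h leaves the integral of
      alpha.w h, where w = (x - y) / |x - y|^2 - x / <x>^2, and
      |w| <= <y> / (<x> |x - y|) by an exact computation ([shift_sqr_le]).
      Hence |Gamma2(x)| is at most a multiple of <x>^(-1) times the integral of
      <y>^(1 - beta) / |x - y|, which decays like <x>^(-d) with
      d = min(1, (beta - 2) / 2) ([integral_majorant]).  So
      |Gamma2| = O(<x>^(- 1 - d)), a bound that is both bounded and square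
      integrable on the plane.

    All integrals over the plane reduce to two: |z|^(-s) on the unit disc for
    s < 2, and <z>^(-s) on the plane for s > 2.  Both are bounded, uniformly in
    the centre, by cutting the plane into dyadic squares
    ([integral_dyadic]). *)

(** * Euclidean length and Japanese bracket *)
Section Length.
Context {R : realType}.
Implicit Types x y z : plane R.

Lemma enorm2_ge0 x : 0 <= enorm2 x.
Proof. exact: sqrtr_ge0. Qed.

Lemma enorm2_sqr x : enorm2 x ^+ 2 = x.1 ^+ 2 + x.2 ^+ 2.
Proof. by rewrite sqr_sqrtr// addr_ge0// sqr_ge0. Qed.

Lemma enorm2_eq0 x : enorm2 x = 0 -> x = 0.
Proof.
move=> x0; have := enorm2_sqr x; rewrite x0 expr0n/= => /esym/eqP.
rewrite paddr_eq0 ?sqr_ge0// !sqrf_eq0 => /andP[/eqP a /eqP b].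
by rewrite [x]surjective_pairing a b.
Qed.

Lemma enorm2B x y : enorm2 (x - y) = enorm2 (y - x).
Proof. by rewrite /enorm2/=; congr Num.sqrt; ring. Qed.

Lemma enorm2_le x (r : R) : 0 <= r -> x.1 ^+ 2 + x.2 ^+ 2 <= r ^+ 2 ->
  enorm2 x <= r.
Proof.
move=> r0 h.
by rewrite -(ler_pXn2r (ltn0Sn 1)) ?nnegrE ?enorm2_ge0// enorm2_sqr.
Qed.

Lemma enorm2_dot x y : x.1 * y.1 + x.2 * y.2 <= enorm2 x * enorm2 y.
Proof.
have [h|h] := leP (x.1 * y.1 + x.2 * y.2) 0.
  by apply: le_trans h _; rewrite mulr_ge0 ?enorm2_ge0.
rewrite -(ler_pXn2r (ltn0Sn 1)) ?nnegrE ?mulr_ge0 ?enorm2_ge0 ?(ltW h)//.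
rewrite exprMn !enorm2_sqr.
have := sqr_ge0 (x.1 * y.2 - x.2 * y.1).
set a := x.1; set b := x.2; set c := y.1; set d := y.2; nra.
Qed.

Lemma enorm2_triangle x y : enorm2 (x + y) <= enorm2 x + enorm2 y.
Proof.
apply: enorm2_le; first by rewrite addr_ge0 ?enorm2_ge0.
rewrite [leRHS]sqrrD !enorm2_sqr /=.
by have := enorm2_dot x y; rewrite /=; nra.
Qed.

Lemma fst_le_enorm2 x : `|x.1| <= enorm2 x.
Proof. by rewrite -sqrtr_sqr ler_wsqrtr// lerDl sqr_ge0. Qed.

Lemma snd_le_enorm2 x : `|x.2| <= enorm2 x.
Proof. by rewrite -sqrtr_sqr ler_wsqrtr// lerDr sqr_ge0. Qed.

Lemma japanese_sqr x : japanese x ^+ 2 = 1 + enorm2 x ^+ 2.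
Proof. by rewrite sqr_sqrtr// addr_ge0// sqr_ge0. Qed.

Lemma japanese_ge1 x : 1 <= japanese x.
Proof. by rewrite -[leLHS]sqrtr1 ler_wsqrtr// lerDl sqr_ge0. Qed.

Lemma japanese_gt0 x : 0 < japanese x.
Proof. exact: lt_le_trans (japanese_ge1 x). Qed.

Lemma japanese_ge0 x : 0 <= japanese x.
Proof. exact: ltW (japanese_gt0 x). Qed.

Lemma enorm2_le_japanese x : enorm2 x <= japanese x.
Proof.
rewrite -(ler_pXn2r (ltn0Sn 1)) ?nnegrE ?enorm2_ge0 ?japanese_ge0//.
by rewrite japanese_sqr lerDr.
Qed.

(** The Japanese bracket is the Euclidean length of (1, x) in dimension 3, so it
    inherits a triangle inequality. *)
Lemma japanese_triangle x y : japanese x <= japanese (x - y) + japanese y.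
Proof.
rewrite -(ler_pXn2r (ltn0Sn 1)) ?nnegrE ?addr_ge0 ?japanese_ge0//.
rewrite [leRHS]sqrrD !japanese_sqr.
have h : enorm2 x <= enorm2 (x - y) + enorm2 y.
  by rewrite -{1}(subrK y x); exact: enorm2_triangle.
have h1 : enorm2 (x - y) * enorm2 y <= japanese (x - y) * japanese y.
  by apply: ler_pM; rewrite ?enorm2_ge0 ?enorm2_le_japanese.
have := enorm2_ge0 x; nra.
Qed.

Lemma measurable_powR_comp d (T : measurableType d) (f : T -> R) p :
  measurable_fun setT f -> measurable_fun setT (fun t => f t `^ p).
Proof. move=> mf; exact: (measurableT_comp (measurable_powR p)). Qed.

Lemma measurable_sqrt_comp d (T : measurableType d) (f : T -> R) :
  (forall t, 0 <= f t) ->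
  measurable_fun setT f -> measurable_fun setT (fun t => Num.sqrt (f t)).
Proof.
move=> f0 mf; under eq_fun do rewrite -powR12_sqrt//.
exact: measurable_powR_comp.
Qed.

Lemma measurable_inv_comp d (T : measurableType d) (f : T -> R) :
  (forall t, 0 <= f t) -> measurable_fun setT f ->
  measurable_fun setT (fun t => (f t)^-1).
Proof.
move=> f0 mf; under eq_fun do rewrite -powR_inv1//.
exact: measurable_powR_comp.
Qed.

Lemma measurable_enorm2B d (T : measurableType d) (f g : T -> plane R) :
  measurable_fun setT f -> measurable_fun setT g ->
  measurable_fun setT (fun t => enorm2 (f t - g t)).
Proof.
move=> mf mg; apply: measurable_sqrt_comp.
  by move=> t; rewrite addr_ge0 ?sqr_ge0.
by apply: measurable_funD; apply: measurable_funX => /=;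
  apply: measurable_funB; apply: measurableT_comp.
Qed.

Lemma measurable_japaneseB d (T : measurableType d) (f g : T -> plane R) :
  measurable_fun setT f -> measurable_fun setT g ->
  measurable_fun setT (fun t => japanese (f t - g t)).
Proof.
move=> mf mg; apply: measurable_sqrt_comp.
  by move=> t; rewrite addr_ge0 ?sqr_ge0.
by apply: measurable_funD => //; apply: measurable_funX;
   exact: measurable_enorm2B.
Qed.

Lemma measurable_japanese : measurable_fun setT (@japanese R).
Proof.
rewrite (_ : japanese = fun t : plane R => japanese (t - cst (0 : plane R) t)).
  exact: measurable_japaneseB.
by apply/funext => t; rewrite /= subr0.
Qed.

End Length.

(** * Integration over dyadic squares *)
Section Dyadic.
Context {R : realType}.
Implicit Types x y z : plane R.

(** Squares stand in for discs: they contain the disc of the same radius and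
    their measure is immediate for a product measure. *)
Definition square x (r : R) : set (plane R) :=
  `[x.1 - r, x.1 + r]%classic `*` `[x.2 - r, x.2 + r]%classic.

Lemma measurable_square x r : measurable (square x r).
Proof. by apply: measurableX; exact: measurable_itv. Qed.

Lemma leb2_square x r : 0 <= r -> leb2 (square x r) = (4 * r ^+ 2)%:E.
Proof.
move=> r0.
have I (a : R) : @lebesgue_measure R `[a - r, a + r]%classic = (2 * r)%:E.
  rewrite lebesgue_measure_itv /= lte_fin; have [rE|rn] := eqVneq r 0.
    by rewrite rE subr0 addr0 ltxx mulr0.
  rewrite ifT; first by rewrite -EFinB; congr EFin; ring.
  by move: rn; rewrite neq_lt; lra.
rewrite /leb2 /square /= product_measure1E; [|exact: measurable_itv..].
by rewrite /= !I -EFinM; congr EFin; ring.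
Qed.

Lemma square_enorm2 x y r : enorm2 (x - y) <= r -> square x r y.
Proof.
move=> h; have := le_trans (fst_le_enorm2 _) h.
have := le_trans (snd_le_enorm2 _) h.
rewrite /= !ler_norml => /andP[a b] /andP[c d].
by split; rewrite /= in_itv /=; apply/andP; split; lra.
Qed.

(** The hypothesis on [f] puts [f] below the sum of the step
    functions c_n 1_(Q_n), Q_n being the square of half-side r_n and area
    4 r_n^2 around [x].  Only the areas enter, hence a bound that does not
    depend on [x] when [c] and [r] do not. *)
Lemma integral_dyadic (c r : nat -> R) (f : plane R -> R) x (S : R) :
  (forall n, 0 <= c n) -> (forall n, 0 <= r n) ->
  (forall y, 0 <= f y) -> measurable_fun setT f ->
  (forall y, f y != 0 -> exists n, f y <= c n /\ enorm2 (x - y) <= r n) ->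
  (forall N, \sum_(0 <= n < N) c n * (4 * r n ^+ 2) <= S) ->
  (\int[leb2]_y (f y)%:E <= S%:E)%E.
Proof.
move=> c0 r0 f0 mf fc cS.
pose g n y : \bar R := (c n * \1_(square x (r n)) y)%:E.
have g0 n y : (0 <= g n y)%E by rewrite lee_fin mulr_ge0.
have mB n : measurable_fun setT (\1_(square x (r n)) : plane R -> R).
  by apply/measurable_indicP; exact (measurable_square x (r n)).
have mg n : measurable_fun setT (g n).
  by apply/measurable_EFinP; exact: measurable_funM.
apply: (@le_trans _ _ (\int[leb2]_y (\sum_(n <oo) g n y))%E).
  apply: ge0_le_integral => //.
  - by move=> y _; rewrite lee_fin.
  - exact/measurable_EFinP.
  - by apply: ge0_emeasurable_sum.
  move=> y _; have [->|/fc[n [fn xy]]] := eqVneq (f y) 0.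
    exact: nneseries_ge0.
  apply: (@le_trans _ _ (g n y)).
    rewrite /g indicE mem_set ?mulr1 ?lee_fin//; exact: square_enorm2.
  by rewrite (@nneseriesD1 _ _ n)// leeDl// nneseries_ge0.
rewrite integral_nneseries//.
apply: lime_le.
  by apply: is_cvg_nneseries => n _ _; exact: integral_ge0.
apply: nearW => N.
rewrite (_ : \sum_(0 <= n < N) _ =
    (\sum_(0 <= n < N) c n * (4 * r n ^+ 2))%:E)%E.
  by rewrite lee_fin.
rewrite -sumEFin; apply: eq_bigr => n _.
rewrite /g; under eq_integral do rewrite EFinM.
rewrite ge0_integralZl_EFin//; last exact/measurable_EFinP.
rewrite integral_indic//; last exact (measurable_square x (r n)).
by rewrite setIT leb2_square// EFinM.
Qed.

End Dyadic.

(** * Integrability of powers of the distance *)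
Section Weights.
Context {R : realType}.
Implicit Types x y z : plane R.

(** |z|^(-s) cut off to the unit disc; it vanishes at the origin when s is not
    0, since [0 `^ (- s)] is 0. *)
Definition local_pow (s : R) z : R :=
  if enorm2 z < 1 then enorm2 z `^ (- s) else 0.

Lemma local_pow_ge0 s z : 0 <= local_pow s z.
Proof. by rewrite /local_pow; case: ifP => // _; exact: powR_ge0. Qed.

Lemma local_powB s x y : local_pow s (x - y) = local_pow s (y - x).
Proof. by rewrite /local_pow enorm2B. Qed.

Lemma measurable_local_powB d (T : measurableType d) s (f g : T -> plane R) :
  measurable_fun setT f -> measurable_fun setT g ->
  measurable_fun setT (fun t => local_pow s (f t - g t)).
Proof.
move=> mf mg; apply: measurable_fun_ifT => //.
  by apply: measurable_fun_ltr => //; exact: measurable_enorm2B.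
by apply: measurable_powR_comp; exact: measurable_enorm2B.
Qed.

Lemma dyadic_bracket (X : R) : 1 <= X -> exists n, 2 ^+ n <= X < 2 ^+ n.+1.
Proof.
move=> X1.
have ex : exists n, X < 2 ^+ n.
  exists (Num.truncn X).+1; apply: lt_le_trans (truncnS_gt X) _.
  by rewrite -natrX ler_nat ltnW// ltn_expl.
case: (ex_minnP ex) => -[|n] Xn min.
  by move: Xn; rewrite expr0 ltNge X1.
exists n; rewrite Xn andbT leNgt; apply/negP => /min.
by rewrite ltnn.
Qed.

Lemma pow2_powR n (s : R) : (2 ^+ n) `^ s = (2 `^ s) ^+ n :> R.
Proof. by rewrite -powR_mulrn// powRAC powR_mulrn// powR_ge0. Qed.

Let two4 : 2 `^ 2 = 4 :> R.
Proof. by rewrite (@powR_mulrn R 2 2)// -natrX. Qed.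

Let four_pow n : 4 ^+ n = (2 ^+ n) ^+ 2 :> R.
Proof. by rewrite exprAC; congr (_ ^+ n); rewrite -natrX. Qed.

Lemma pow2_lt1 (t : R) : t < 0 -> 2 `^ t < 1.
Proof.
move=> t0; rewrite /powR pnatr_eq0/= expR_lt1 nmulr_rlt0// ln_gt0//.
by rewrite ltr1n.
Qed.

Lemma geometric_sum_le (a q : R) N : 0 <= a -> 0 < q < 1 ->
  \sum_(0 <= n < N) a * q ^+ n <= a / (1 - q).
Proof.
move=> a0 /andP[q0 q1]; have := @geometric_le_lim _ N a q a0 q0.
by rewrite gtr0_norm// => /(_ q1).
Qed.

(** On the annulus 2^(-n-1) < |z| <= 2^(-n) the integrand is at most
    2^((n+1) s), against an area of order 4^(-n): the series is geometric of
    ratio 2^(s-2). *)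
Lemma integral_local_pow s : 0 < s < 2 -> exists2 A : R, 0 <= A &
  forall x, (\int[leb2]_y (local_pow s (x - y))%:E <= A%:E)%E.
Proof.
move=> /andP[s0 s2]; pose q : R := 2 `^ (s - 2).
have q0 : 0 < q by rewrite powR_gt0.
have q1 : q < 1 by rewrite pow2_lt1// subr_lt0.
pose a : R := 4 * 2 `^ s.
have a0 : 0 <= a by rewrite mulr_ge0// powR_ge0.
exists (a / (1 - q)); first by rewrite divr_ge0// subr_ge0 ltW.
move=> x; apply: (@integral_dyadic _ (fun n => (2 ^+ n.+1) `^ s)
  (fun n => 2 ^- n) _ x) => //.
- by move=> y; exact: local_pow_ge0.
- exact: measurable_local_powB.
- move=> y; rewrite /local_pow; case: ifP; last by rewrite eqxx.
  move=> d1; set d := enorm2 _ => dn0.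
  have d0 : 0 < d.
    rewrite lt_neqAle enorm2_ge0 andbT eq_sym.
    by apply: contraNneq dn0 => ->; rewrite powR0// oppr_eq0 gt_eqF.
  have [|n /andP[nd dn]] := @dyadic_bracket d^-1.
    by rewrite invf_ge1// ltW.
  exists n; split; last by rewrite -[d]invrK lef_pV2 ?posrE ?exprn_gt0 ?invr_gt0.
  rewrite powRN -[_^-1]powRN.
  have -> : d `^ (- s) = (d^-1) `^ s.
    by rewrite -powR_inv1 ?ltW// -powRrM mulN1r.
  by rewrite ge0_ler_powR ?nnegrE ?invr_ge0 ?exprn_ge0// ltW.
move=> N; apply: le_trans (geometric_sum_le N a0 _); last by rewrite q0 q1.
rewrite le_eqVlt; apply/orP; left; apply/eqP; apply: eq_bigr => n _.
rewrite pow2_powR /q powRB ?(implybT)//; last by rewrite pnatr_eq0 implybT.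
rewrite two4 exprMn exprS /a !exprVn four_pow; ring.
Qed.

(** Where 2^n <= <z> < 2^(n+1) the integrand is at most 2^(-n s), against an
    area of order 4^n: the series is geometric of ratio 2^(2-s). *)
Lemma integral_japanese s : 2 < s -> exists2 A : R, 0 <= A &
  forall x, (\int[leb2]_y (japanese (x - y) `^ (- s))%:E <= A%:E)%E.
Proof.
move=> s2; pose q : R := 2 `^ (2 - s).
have q0 : 0 < q by rewrite powR_gt0.
have q1 : q < 1 by rewrite pow2_lt1// subr_lt0.
exists (16 / (1 - q)); first by rewrite divr_ge0// subr_ge0 ltW.
move=> x; apply: (@integral_dyadic _ (fun n => (2 ^+ n) `^ (- s))
  (fun n => 2 ^+ n.+1) _ x) => //.
- by move=> y; exact: powR_ge0.
- by apply: measurable_powR_comp; exact: measurable_japaneseB.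
- move=> y _; have [n /andP[nd dn]] := dyadic_bracket (japanese_ge1 (x - y)).
  exists n; split; last exact: le_trans (enorm2_le_japanese _) (ltW dn).
  rewrite !powRN lef_pV2 ?posrE ?powR_gt0 ?japanese_gt0 ?exprn_gt0//.
  rewrite ge0_ler_powR ?nnegrE ?japanese_ge0 ?exprn_ge0//.
  exact: le_trans (ltW s2).
move=> N; apply: le_trans (geometric_sum_le N _ _) => //; last by rewrite q0 q1.
rewrite le_eqVlt; apply/orP; left; apply/eqP; apply: eq_bigr => n _.
rewrite powRN pow2_powR /q powRB ?(implybT)//; last by rewrite pnatr_eq0 implybT.
rewrite two4 exprMn !exprVn four_pow (exprS 2 n); ring.
Qed.

End Weights.

(** * Potentials with kernel 1 / |x - y| *)
Section Potential.
Context {R : realType}.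
Implicit Types x y z : plane R.
Implicit Types f g h : plane R -> R.

Local Notation I f := (\int[leb2]_y (f y)%:E)%E.

Lemma leb2_sigma_finiteT : sigma_finite setT (@leb2 R).
Proof.
exists (fun n => square 0 n%:R).
  apply/esym; rewrite -subTset => x _.
  exists (Num.truncn (enorm2 (0 - x))).+1 => //; apply: square_enorm2.
  exact/ltW/truncnS_gt.
move=> n; split; first exact (measurable_square 0 n%:R).
by rewrite leb2_square// ltry.
Qed.

(** A copy of [leb2] whose head symbol is a new constant, so that the
    sigma-finiteness needed by the Fubini-Tonelli theorem can be attached to
    it by inference. *)
Definition leb2_set : set (plane R) -> \bar R := @leb2 R.
HB.instance Definition _ := Measure.copy leb2_set (@leb2 R).
HB.instance Definition _ := Measure_isSigmaFinite.Build _ _ _ leb2_set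
  leb2_sigma_finiteT.
Definition leb2_sigma_finite : {sigma_finite_measure set (plane R) -> \bar R} :=
  leb2_set.

Lemma leb2_fubini_tonelli (f : plane R * plane R -> \bar R) :
  measurable_fun setT f -> (forall p, 0 <= f p)%E ->
  (\int[leb2]_x \int[leb2]_y f (x, y) = \int[leb2]_y \int[leb2]_x f (x, y))%E.
Proof.
exact: (@fubini_tonelli _ _ _ _ R leb2_sigma_finite leb2_sigma_finite f).
Qed.

Lemma measurable_integral_leb2 (f : plane R * plane R -> \bar R) :
  measurable_fun setT f -> (forall p, 0 <= f p)%E ->
  measurable_fun setT (fun x => \int[leb2]_y f (x, y))%E.
Proof.
exact: (@measurable_fun_fubini_tonelli_F _ _ _ _ R leb2_sigma_finite f).
Qed.

Lemma ge0_le_integralZ f (c B : R) : 0 <= c -> (forall y, 0 <= f y) ->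
  measurable_fun setT f -> (I f <= B%:E)%E ->
  (\int[leb2]_y (c * f y)%:E <= (c * B)%:E)%E.
Proof.
move=> c0 f0 mf fB; under eq_integral do rewrite EFinM.
rewrite ge0_integralZl_EFin//.
- by rewrite EFinM lee_wpmul2l// lee_fin.
- by move=> y _; rewrite lee_fin.
- exact/measurable_EFinP.
Qed.

Lemma ge0_le_integralD f g (a b : R) : (forall y, 0 <= f y) ->
  (forall y, 0 <= g y) -> measurable_fun setT f -> measurable_fun setT g ->
  (I f <= a%:E)%E -> (I g <= b%:E)%E ->
  (\int[leb2]_y (f y + g y)%:E <= (a + b)%:E)%E.
Proof.
move=> f0 g0 mf mg fa gb; under eq_integral do rewrite EFinD.
rewrite ge0_integralD//; first by rewrite EFinD leeD.
- by move=> y _; rewrite lee_fin.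
- exact/measurable_EFinP.
- by move=> y _; rewrite lee_fin.
- exact/measurable_EFinP.
Qed.

Lemma inv_enorm2_le z : (enorm2 z)^-1 <= local_pow 1 z + 1.
Proof.
rewrite /local_pow; case: ifPn => [z1|].
  by rewrite powR_inv1 ?enorm2_ge0// lerDl.
by rewrite -leNgt add0r => z1; rewrite invf_le1 ?(lt_le_trans _ z1).
Qed.

(** 2 t u^2 v^2 <= t^2 u v + u^3 v^3 is the inequality of arithmetic and
    geometric means for t (u v)^(1/2) and (u v)^(3/2); and
    u v <= u^2 + v^2 <= u^3 + v^3, since neither u nor v lies in ]0, 1[. *)
Lemma young_cube (t u v : R) : 0 <= u -> 0 <= v ->
  (u = 0 \/ 1 <= u) -> (v = 0 \/ 1 <= v) ->
  t * u ^+ 2 * v ^+ 2 <= t ^+ 2 * (u ^+ 3 + v ^+ 3) + u ^+ 3 * v ^+ 3.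
Proof.
move=> u0 v0 u1 v1; have uv0 : 0 <= u * v by exact: mulr_ge0.
have sq_le_cube (a : R) : 0 <= a -> (a = 0 \/ 1 <= a) -> a ^+ 2 <= a ^+ 3.
  move=> a0 [->|a1]; first by rewrite !expr0n.
  by rewrite [leRHS]exprS ler_peMl ?sqr_ge0.
have uv_le : u * v <= u ^+ 3 + v ^+ 3.
  have := sq_le_cube _ u0 u1; have := sq_le_cube _ v0 v1.
  have := sqr_ge0 (u - v); rewrite sqrrB.
  have := sqr_ge0 u; have := sqr_ge0 v; lra.
have h2 : 0 <= u * v * (t - u * v) ^+ 2 by exact: mulr_ge0 uv0 (sqr_ge0 _).
have h3 := ler_wpM2l (sqr_ge0 t) uv_le.
have h4 := mulr_ge0 (sqr_ge0 t) uv0.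
have h5 := mulr_ge0 (exprn_ge0 3 u0) (exprn_ge0 3 v0).
have -> : t * u ^+ 2 * v ^+ 2 =
  (t ^+ 2 * (u * v) + u ^+ 3 * v ^+ 3 - u * v * (t - u * v) ^+ 2) / 2 by field.
lra.
Qed.

(** The splitting behind the bootstrap.  With [t] a density at z, [a = x - y]
    and [b = y - z], each term on the right can be integrated over y and z:
    t^2 meets a kernel that is integrable in y uniformly in z, and the last
    product is integrated in z and then in y.  The exponent 3/2 is below 2,
    hence still locally integrable in the plane. *)
Lemma local_pow_young (t : R) a b :
  t * local_pow 1 a * local_pow 1 b <=
    t ^+ 2 * (local_pow (3 / 2) a + local_pow (3 / 2) b) +
    local_pow (3 / 2) a * local_pow (3 / 2) b.
Proof.
have pw k r : 0 <= r -> r `^ (- (k%:R / 2)) = (r `^ (- 2^-1)) ^+ k :> R.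
  by move=> r0; rewrite -powR_mulrn ?powR_ge0// -powRrM; congr (_ `^ _); ring.
have [a1|a1] := ltP (enorm2 a) 1; last first.
  rewrite {1 3 5}/local_pow ltNge a1/= !(mulr0, mul0r) !addr0 add0r.
  by rewrite mulr_ge0 ?sqr_ge0 ?local_pow_ge0.
have [b1|b1] := ltP (enorm2 b) 1; last first.
  rewrite {2 4 6}/local_pow ltNge b1/= !(mulr0, mul0r) !addr0.
  by rewrite mulr_ge0 ?sqr_ge0 ?local_pow_ge0.
rewrite /local_pow a1 b1.
(* Both powers are expressed through |a|^(-1/2) and |b|^(-1/2). *)
have pw1 r : 0 <= r -> r `^ (- 1) = (r `^ (- 2^-1)) ^+ 2 :> R.
  by move=> r0; rewrite -pw// divff.
rewrite !pw1 ?(pw 3) ?enorm2_ge0//.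
have pge1 c : enorm2 c < 1 ->
    (enorm2 c) `^ (- 2^-1) = 0 \/ 1 <= (enorm2 c) `^ (- 2^-1) :> R.
  move=> c1; have [->|c0] := eqVneq (enorm2 c) 0.
    by left; rewrite powR0// oppr_eq0 invr_eq0 pnatr_eq0.
  right; have cp : 0 < enorm2 c by rewrite lt_neqAle eq_sym c0 enorm2_ge0.
  rewrite powRN invf_ge1 ?powR_gt0//.
  have : enorm2 c `^ 2^-1 <= 1 `^ 2^-1.
    by rewrite ge0_ler_powR ?nnegrE ?invr_ge0 ?(ltW c1)// ltW.
  by rewrite powR1.
move: (pge1 _ a1) (pge1 _ b1).
set u := _ `^ _; set v := _ `^ _ => u1 v1.
exact: young_cube (powR_ge0 _ _) (powR_ge0 _ _) u1 v1.
Qed.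

(** Away from the diagonal the kernel is at most 1 and [h] in L^1 suffices.
    Near the diagonal, [h y] is replaced by [C] times its potential; the
    resulting double integral is split by [local_pow_young] and each piece is
    finite by Tonelli, [h] in L^1 and [h] in L^2.  The bound on [h] is needed
    only almost everywhere because it is used under an integral. *)
Lemma potential_bounded h (C H1 H2 : R) : 0 <= C -> (forall y, 0 <= h y) ->
  measurable_fun setT h ->
  (I h <= H1%:E)%E -> (\int[leb2]_y (h y ^+ 2)%:E <= H2%:E)%E ->
  {ae leb2, forall y,
     ((h y)%:E <= C%:E * \int[leb2]_z ((enorm2 (y - z))^-1 * h z)%:E)%E} ->
  exists M : R, forall x,
    (\int[leb2]_y ((enorm2 (x - y))^-1 * h y)%:E <= M%:E)%E.
Proof.
move=> C0 h0 mh hH1 hH2 hP.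
have [A1 A10 hA1] := @integral_local_pow R 1 ltac:(lra).
have [A A0 hA] := @integral_local_pow R (3 / 2) ltac:(lra).
have minv d (T : measurableType d) (f g : T -> plane R) :
  measurable_fun setT f -> measurable_fun setT g ->
  measurable_fun setT (fun t => (enorm2 (f t - g t))^-1).
  move=> mf mg; apply: measurable_inv_comp; last exact: measurable_enorm2B.
  by move=> t; exact: enorm2_ge0.
have mn s x : measurable_fun setT (fun y : plane R => local_pow s (x - y)).
  exact: measurable_local_powB.
have mh2 : measurable_fun setT (fun y => h y ^+ 2) by exact: measurable_funX.
have H10 : 0 <= H1.
  by rewrite -lee_fin (le_trans _ hH1)// integral_ge0// => y _; rewrite lee_fin.
have H20 : 0 <= H2.
  rewrite -lee_fin (le_trans _ hH2)// integral_ge0// => y _.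
  by rewrite lee_fin sqr_ge0.
pose P y := (\int[leb2]_z ((enorm2 (y - z))^-1 * h z)%:E)%E.
pose G y := (\int[leb2]_z (h z ^+ 2 * local_pow (3 / 2) (y - z))%:E)%E.
have mP : measurable_fun setT P.
  apply: (@measurable_integral_leb2
    (fun p => ((enorm2 (p.1 - p.2))^-1 * h p.2)%:E)).
    apply/measurable_EFinP; apply: measurable_funM; first exact: minv.
    exact: measurableT_comp.
  by move=> p; rewrite lee_fin mulr_ge0// invr_ge0 enorm2_ge0.
have P0 y : (0 <= P y)%E.
  by apply: integral_ge0 => z _; rewrite lee_fin mulr_ge0// invr_ge0 enorm2_ge0.
have mhn : measurable_fun setT
    (fun p : plane R * plane R =>
      (h p.2 ^+ 2 * local_pow (3 / 2) (p.1 - p.2))%:E).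
  apply/measurable_EFinP; apply: measurable_funM.
    exact: (measurableT_comp mh2).
  exact: measurable_local_powB.
have hn0 (p : plane R * plane R) :
    (0 <= (h p.2 ^+ 2 * local_pow (3 / 2) (p.1 - p.2))%:E)%E.
  by rewrite lee_fin mulr_ge0 ?sqr_ge0 ?local_pow_ge0.
have mG : measurable_fun setT G by exact: measurable_integral_leb2 mhn hn0.
have G0 y : (0 <= G y)%E by apply: integral_ge0 => z _; exact: (hn0 (y, z)).
(* The only piece in which y has to be integrated before z. *)
have iG : (\int[leb2]_y G y <= (A * H2)%:E)%E.
  rewrite /G (leb2_fubini_tonelli mhn hn0)/=.
  apply: (@le_trans _ _ (\int[leb2]_z (A * h z ^+ 2)%:E)%E).
    apply: ge0_le_integral.
    - exact: measurableT.
    - by move=> z _; apply: integral_ge0 => y _; exact: (hn0 (y, z)).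
    - apply: (@measurable_integral_leb2
        (fun p => (h p.1 ^+ 2 * local_pow (3 / 2) (p.2 - p.1))%:E)).
        apply/measurable_EFinP; apply: measurable_funM.
          exact: (measurableT_comp mh2).
        exact: measurable_local_powB.
      by move=> p; rewrite lee_fin mulr_ge0 ?sqr_ge0 ?local_pow_ge0.
    - by apply/measurable_EFinP; exact: measurable_funM.
    move=> z _; rewrite [(A * _)%R]mulrC; apply: ge0_le_integralZ.
    - exact: sqr_ge0.
    - by move=> y; exact: local_pow_ge0.
    - exact: measurable_local_powB.
    - by under eq_integral do rewrite local_powB; exact: hA.
  by apply: ge0_le_integralZ => // y; exact: sqr_ge0.
have step x y : ((local_pow 1 (x - y))%:E * P y <=
    (H1 * local_pow 1 (x - y) + (H2 + A) * local_pow (3 / 2) (x - y))%:E +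
    G y)%E.
  set c := local_pow 1 (x - y); set n := local_pow (3 / 2) (x - y).
  have c0 : 0 <= c by exact: local_pow_ge0.
  have n0 : 0 <= n by exact: local_pow_ge0.
  have nyz0 z : 0 <= local_pow (3 / 2) (y - z) by exact: local_pow_ge0.
  have h20 z : 0 <= h z ^+ 2 by exact: sqr_ge0.
  pose F z := c * h z + (n * h z ^+ 2 + n * local_pow (3 / 2) (y - z)).
  have mF1 : measurable_fun setT
      (fun z => n * h z ^+ 2 + n * local_pow (3 / 2) (y - z)).
    by apply: measurable_funD; exact: measurable_funM.
  have mcH : measurable_fun setT (fun z => c * h z) by exact: measurable_funM.
  have mF : measurable_fun setT F by exact: measurable_funD.
  have F10 z : 0 <= n * h z ^+ 2 + n * local_pow (3 / 2) (y - z).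
    by rewrite addr_ge0 ?mulr_ge0.
  have F0 z : 0 <= F z by rewrite addr_ge0 ?mulr_ge0.
  have mhny : measurable_fun setT
      (fun z => h z ^+ 2 * local_pow (3 / 2) (y - z)).
    exact: measurable_funM.
  rewrite /P -ge0_integralZl_EFin//; last 2 first.
  - by move=> z _; rewrite lee_fin mulr_ge0// invr_ge0 enorm2_ge0.
  - by apply/measurable_EFinP; apply: measurable_funM => //; exact: minv.
  apply: (@le_trans _ _
    (\int[leb2]_z ((F z)%:E + (h z ^+ 2 * local_pow (3 / 2) (y - z))%:E))%E).
    apply: ge0_le_integral => //.
    - by move=> z _; rewrite lee_fin !mulr_ge0// invr_ge0 enorm2_ge0.
    - apply/measurable_EFinP; apply: measurable_funM => //.
      by apply: measurable_funM => //; exact: minv.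
    - by apply: emeasurable_funD; exact/measurable_EFinP.
    move=> z _; rewrite -EFinM -EFinD lee_fin.
    have := local_pow_young (h z) (x - y) (y - z); rewrite -/c -/n /F.
    have := inv_enorm2_le (y - z).
    move=> /(ler_wpM2r (mulr_ge0 c0 (h0 z))); lra.
  rewrite ge0_integralD//; last 4 first.
  - by move=> z _; rewrite lee_fin.
  - exact/measurable_EFinP.
  - by move=> z _; exact: (hn0 (y, z)).
  - exact/measurable_EFinP.
  rewrite leeD//.
  have -> : H1 * c + (H2 + A) * n = c * H1 + (n * H2 + n * A) by ring.
  apply: ge0_le_integralD => //.
  - by move=> z; rewrite mulr_ge0.
  - exact: ge0_le_integralZ.
  apply: ge0_le_integralD => //.
  - by move=> z; rewrite mulr_ge0.
  - by move=> z; rewrite mulr_ge0.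
  - exact: measurable_funM.
  - exact: measurable_funM.
  - exact: ge0_le_integralZ.
  - exact: ge0_le_integralZ.
exists (H1 + C * (H1 * A1 + (H2 + A) * A + A * H2)) => x.
pose K y := H1 * local_pow 1 (x - y) + (H2 + A) * local_pow (3 / 2) (x - y).
have n10 y : 0 <= local_pow 1 (x - y) by exact: local_pow_ge0.
have n0 y : 0 <= local_pow (3 / 2) (x - y) by exact: local_pow_ge0.
have mK : measurable_fun setT K.
  by apply: measurable_funD; exact: measurable_funM.
have K0 y : 0 <= K y by rewrite addr_ge0 ?mulr_ge0 ?addr_ge0.
have iK : (I K <= (H1 * A1 + (H2 + A) * A)%:E)%E.
  apply: ge0_le_integralD => //.
  - by move=> y; rewrite mulr_ge0.
  - by move=> y; rewrite mulr_ge0 ?addr_ge0.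
  - exact: measurable_funM.
  - exact: measurable_funM.
  - exact: ge0_le_integralZ.
  - by apply: ge0_le_integralZ => //; rewrite addr_ge0.
apply: (@le_trans _ _ (\int[leb2]_y (h y + local_pow 1 (x - y) * h y)%:E)%E).
  apply: ge0_le_integral => //.
  - by move=> y _; rewrite lee_fin mulr_ge0// invr_ge0 enorm2_ge0.
  - by apply/measurable_EFinP; apply: measurable_funM => //; exact: minv.
  - apply/measurable_EFinP; apply: measurable_funD => //.
    exact: measurable_funM.
  move=> y _; rewrite lee_fin.
  by have := ler_wpM2r (h0 y) (inv_enorm2_le (x - y)); lra.
apply: ge0_le_integralD => //.
- by move=> y; rewrite mulr_ge0.
- exact: measurable_funM.
apply: (@le_trans _ _ (\int[leb2]_y (C%:E * ((K y)%:E + G y)))%E).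
  apply: ae_ge0_le_integral => //.
  - by move=> y _; rewrite lee_fin mulr_ge0.
  - by apply/measurable_EFinP; exact: measurable_funM.
  - by move=> y _; rewrite mule_ge0 ?lee_fin// adde_ge0 ?lee_fin.
  - apply: measurable_funeM; apply: emeasurable_funD => //.
    exact/measurable_EFinP.
  apply: filterS hP => y hy _.
  rewrite EFinM.
  apply: (@le_trans _ _ ((local_pow 1 (x - y))%:E * (C%:E * P y))%E).
    by rewrite lee_wpmul2l// lee_fin.
  by rewrite muleCA lee_wpmul2l ?lee_fin.
rewrite ge0_integralZl_EFin//; last 2 first.
- by move=> y _; rewrite adde_ge0 ?lee_fin.
- by apply: emeasurable_funD => //; exact/measurable_EFinP.
rewrite EFinM lee_wpmul2l ?lee_fin//.
rewrite ge0_integralD//; last 2 first.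
- by move=> y _; rewrite lee_fin.
- exact/measurable_EFinP.
by rewrite EFinD leeD.
Qed.

(** The larger of the two bases may be replaced by the smaller one in its own
    factor.  This trades a product of weights centred at two different points,
    none of them integrable alone, for integrable weights. *)
Lemma powR_prod_le (Y Z p q : R) : 1 <= Y -> 1 <= Z -> 0 <= p -> 0 <= q ->
  Y `^ (- p) * Z `^ (- q) <= Y `^ (- (p + q)) + Z `^ (- (p + q)).
Proof.
move=> Y1 Z1 p0 q0; have Y0 : 0 < Y by lra.
have Z0 : 0 < Z by lra.
have D a : 0 < a -> a `^ (- (p + q)) = a `^ (- p) * a `^ (- q).
  by move=> a0; rewrite opprD powRD//; apply/implyP => _; rewrite gt_eqF.
rewrite !D//.
have le a b r : 0 < a -> a <= b -> 0 <= r -> b `^ (- r) <= a `^ (- r).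
  move=> a0 ab r0; have b0 := lt_le_trans a0 ab.
  rewrite !powRN lef_pV2 ?posrE ?powR_gt0//.
  by rewrite ge0_ler_powR ?nnegrE ?(ltW a0) ?(ltW b0).
have [YZ|/ltW ZY] := leP Y Z.
  apply: ler_wpDr; first by rewrite mulr_ge0 ?powR_ge0.
  by rewrite ler_wpM2l ?powR_ge0 ?le.
apply: ler_wpDl; first by rewrite mulr_ge0 ?powR_ge0.
by rewrite ler_wpM2r ?powR_ge0 ?le.
Qed.

(** An upper bound for 1 / |z|, split into a locally integrable part and a part
    comparable to 1 / <z>.  It is positive at the origin, where the inverse
    of |z| is 0 by convention but the kernel difference is not. *)
Definition majorant z : R := local_pow (3 / 2) z + 3 * (japanese z)^-1.

Lemma majorant_ge0 z : 0 <= majorant z.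
Proof.
by rewrite addr_ge0 ?local_pow_ge0// mulr_ge0// invr_ge0 japanese_ge0.
Qed.

Lemma measurable_majorantB d (T : measurableType d) (f g : T -> plane R) :
  measurable_fun setT f -> measurable_fun setT g ->
  measurable_fun setT (fun t => majorant (f t - g t)).
Proof.
move=> mf mg; apply: measurable_funD; first exact: measurable_local_powB.
apply: measurable_funM => //.
under eq_fun do rewrite -powR_inv1 ?japanese_ge0//.
by apply: measurable_powR_comp; exact: measurable_japaneseB.
Qed.

Lemma japanese0B y : japanese (0 - y) = japanese y.
Proof. by rewrite /japanese enorm2B subr0. Qed.

Lemma powRD_gt0 (a r s : R) : 0 < a -> a `^ r * a `^ s = a `^ (r + s).
Proof. by move=> a0; rewrite powRD//; apply/implyP => _; rewrite gt_eqF. Qed.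

Lemma powR_gain (a r : R) : 0 < a ->
  a `^ r * a `^ (- (1 + 2 * r)) = a `^ (- (1 + r)).
Proof. by move=> a0; rewrite powRD_gt0//; congr (_ `^ _); ring. Qed.

Lemma powR_divr (a r : R) : 0 < a -> a `^ r * a^-1 = a `^ (- (1 - r)).
Proof. by move=> a0; rewrite -(powR_inv1 (ltW a0)) powRD_gt0// opprB. Qed.

Lemma powR_le1 (a r : R) : 1 <= a -> 0 <= r -> a `^ (- r) <= 1.
Proof. by move=> a1 r0; rewrite -[leRHS](powRr0 a) ler_powR// oppr_le0. Qed.

Lemma powR_subadditive (X Y Z d : R) : 0 <= X -> 0 <= Y -> 0 <= Z ->
  0 <= d <= 1 -> X <= Y + Z -> X `^ d <= 2 * (Y `^ d + Z `^ d).
Proof.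
move=> X0 Y0 Z0 /andP[d0 d1] XYZ.
have two : 2 `^ d <= 2 :> R by rewrite ler1_powR// ler1n.
have mono m : 0 <= m -> X <= 2 * m -> X `^ d <= 2 * m `^ d.
  move=> m0 Xm; apply: (@le_trans _ _ ((2 * m) `^ d)).
    by rewrite ge0_ler_powR ?nnegrE ?mulr_ge0.
  by rewrite powRM ?ler_wpM2r ?powR_ge0.
rewrite mulrDr; have [YZ|/ltW ZY] := leP Y Z.
  rewrite ler_wpDl ?mulr_ge0 ?powR_ge0// mono// (le_trans XYZ)//.
  by rewrite mulr2n mulrDl mul1r lerD2r.
rewrite ler_wpDr ?mulr_ge0 ?powR_ge0// mono// (le_trans XYZ)//.
by rewrite mulr2n mulrDl mul1r lerD2l.
Qed.

(** The bookkeeping of [majorant_pointwise], with plain variables for the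
    powers: Xd, Yd, Zd are the powers of exponent d, Yw the weight in y and Zi
    the inverse of <x - y>. *)
Lemma weight_combine (Xd Yd Zd Yw Zi n S : R) :
  0 <= n -> 0 <= Yw -> 0 <= Zi -> Xd <= 2 * (Yd + Zd) ->
  Yd * Yw * n <= n -> Zd * Yw * n <= 2 * n ->
  Yd * Yw * Zi <= S -> Zd * Yw * Zi <= S ->
  Xd * (Yw * (n + 3 * Zi)) <= 6 * n + 12 * S.
Proof.
move=> n0 Yw0 Zi0 hX h1 h2 h3 h4.
have w0 : 0 <= Yw * (n + 3 * Zi) by rewrite mulr_ge0// addr_ge0// mulr_ge0.
apply: le_trans (ler_wpM2r w0 hX) _.
have -> : 2 * (Yd + Zd) * (Yw * (n + 3 * Zi)) =
  2 * (Yd * Yw * n + Zd * Yw * n) + 6 * (Yd * Yw * Zi + Zd * Yw * Zi) by ring.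
lra.
Qed.

(** <x>^d is distributed over <y>^d and <x - y>^d by the triangle inequality.
    The first lowers the decay of the weight in y from 1 + 2 d to 1 + d; the
    second is harmless on the local part, where <x - y> <= 2, and lowers the
    decay of 1 / <x - y> from 1 to 1 - d.  In both cases the exponents still add
    up to 2 + d, above the dimension. *)
Lemma majorant_pointwise (d : R) x y : 0 < d <= 1 ->
  japanese x `^ d * (japanese y `^ (- (1 + 2 * d)) * majorant (x - y)) <=
  6 * local_pow (3 / 2) (x - y) +
  12 * (japanese y `^ (- (2 + d)) + japanese (x - y) `^ (- (2 + d))).
Proof.
move=> /andP[d0 d1].
have p1 : 0 <= 1 + d by lra.
have p2 : 0 <= 1 + 2 * d by lra.
have p3 : 0 <= 1 - d by lra.
have q1 : 2 + d = (1 + d) + 1 by ring.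
have q2 : 2 + d = (1 + 2 * d) + (1 - d) by ring.
have X1 := japanese_ge1 x; have Y1 := japanese_ge1 y.
have Z1 := japanese_ge1 (x - y).
have Y0 := japanese_gt0 y; have Z0 := japanese_gt0 (x - y).
have n0 := local_pow_ge0 (3 / 2) (x - y).
have nZ : local_pow (3 / 2) (x - y) = 0 \/ japanese (x - y) <= 2.
  rewrite /local_pow; case: ifPn => [z1|_]; [right|by left].
  rewrite -(ler_pXn2r (ltn0Sn 1)) ?nnegrE ?japanese_ge0// japanese_sqr.
  have : enorm2 (x - y) ^+ 2 <= 1 by rewrite exprn_ile1 ?enorm2_ge0// ltW.
  by rewrite -natrX; lra.
have E1 := powR_gain d Y0.
have E2 := powR_divr d Z0.
have E3 : (japanese (x - y))^-1 = japanese (x - y) `^ (- 1).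
  exact: esym (powR_inv1 (ltW Z0)).
rewrite /majorant.
apply: (weight_combine (Yd := japanese y `^ d) (Zd := japanese (x - y) `^ d)
  n0 (powR_ge0 _ _)).
- by rewrite invr_ge0 ltW.
- have d01 : 0 <= d <= 1 by rewrite (ltW d0).
  apply: (powR_subadditive (japanese_ge0 x) (ltW Y0) (ltW Z0) d01).
  by rewrite addrC; exact: japanese_triangle.
- by rewrite E1 ler_piMl// powR_le1.
- case: nZ => [->|Z2]; first by rewrite !mulr0.
  have h := ler_pM (powR_ge0 _ _) (powR_ge0 _ _)
    (le_trans (ler1_powR Z1 d1) Z2) (powR_le1 Y1 p2).
  by rewrite mulr1 in h; exact: (ler_wpM2r n0 h).
- rewrite E1 E3 q1.
  exact: powR_prod_le.
rewrite mulrAC E2 mulrC q2.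
exact: powR_prod_le.
Qed.

Lemma ge0_le_integral_comb (f g1 g2 g3 : plane R -> R) (a b A B : R) :
  0 <= a -> 0 <= b ->
  (forall y, 0 <= f y) -> (forall y, 0 <= g1 y) -> (forall y, 0 <= g2 y) ->
  (forall y, 0 <= g3 y) ->
  measurable_fun setT f -> measurable_fun setT g1 -> measurable_fun setT g2 ->
  measurable_fun setT g3 ->
  (forall y, f y <= a * g1 y + b * (g2 y + g3 y)) ->
  (I g1 <= A%:E)%E -> (I g2 <= B%:E)%E -> (I g3 <= B%:E)%E ->
  (I f <= (a * A + b * (B + B))%:E)%E.
Proof.
move=> a0 b0 f0 g10 g20 g30 mf mg1 mg2 mg3 fg i1 i2 i3.
apply: (@le_trans _ _ (\int[leb2]_y (a * g1 y + b * (g2 y + g3 y))%:E)%E).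
  apply: ge0_le_integral => //.
  - by move=> y _; rewrite lee_fin.
  - exact/measurable_EFinP.
  - apply/measurable_EFinP; apply: measurable_funD; apply: measurable_funM => //.
    exact: measurable_funD.
  - by move=> y _; rewrite lee_fin.
apply: ge0_le_integralD.
- by move=> y; rewrite mulr_ge0.
- by move=> y; rewrite mulr_ge0 ?addr_ge0.
- exact: measurable_funM.
- by apply: measurable_funM => //; exact: measurable_funD.
- exact: ge0_le_integralZ.
apply: ge0_le_integralZ => //; first by move=> y; rewrite addr_ge0.
  exact: measurable_funD.
exact: ge0_le_integralD.
Qed.

Lemma measurable_japanese_powR (r : R) :
  measurable_fun setT (fun y : plane R => japanese y `^ r).
Proof. by apply: measurable_powR_comp; exact: measurable_japanese. Qed.

Lemma measurable_japaneseB_powR (r : R) x :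
  measurable_fun setT (fun y : plane R => japanese (x - y) `^ r).
Proof. by apply: measurable_powR_comp; exact: measurable_japaneseB. Qed.

Lemma measurable_weight_majorant (r : R) x :
  measurable_fun setT (fun y : plane R => japanese y `^ r * majorant (x - y)).
Proof.
apply: measurable_funM; first exact: measurable_japanese_powR.
exact: measurable_majorantB.
Qed.

(** The gain <x>^(-d) comes from multiplying the integrand by <x>^d and finding
    that it stays integrable, uniformly in [x]. *)
Lemma integral_majorant (d : R) : 0 < d <= 1 -> exists2 C : R, 0 <= C &
  forall x, (\int[leb2]_y (japanese y `^ (- (1 + 2 * d)) * majorant (x - y))%:E
    <= (C * japanese x `^ (- d))%:E)%E.
Proof.
move=> d01.
have d2 : 2 < 2 + d by case/andP: d01; lra.
have [A A0 hA] := @integral_local_pow R (3 / 2) ltac:(lra).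
have [B B0 hB] := @integral_japanese R (2 + d) d2.
exists (6 * A + 12 * (B + B)); first by rewrite addr_ge0 ?mulr_ge0 ?addr_ge0.
move=> x; have Xd0 := powR_gt0 d (japanese_gt0 x).
have F0 y : 0 <= japanese y `^ (- (1 + 2 * d)) * majorant (x - y).
  exact: mulr_ge0 (powR_ge0 _ _) (majorant_ge0 _).
have mF := @measurable_weight_majorant (- (1 + 2 * d)) x.
have iF : (\int[leb2]_y
    (japanese x `^ d * (japanese y `^ (- (1 + 2 * d)) * majorant (x - y)))%:E <=
    (6 * A + 12 * (B + B))%:E)%E.
  apply: (ge0_le_integral_comb
    (g1 := fun y => local_pow (3 / 2) (x - y))
    (g2 := fun y => japanese y `^ (- (2 + d)))
    (g3 := fun y => japanese (x - y) `^ (- (2 + d)))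
    (ler0n _ _) (ler0n _ _)).
  - by move=> y; exact: mulr_ge0 (ltW Xd0) (F0 y).
  - by move=> y; exact: local_pow_ge0.
  - by move=> y; exact: powR_ge0.
  - by move=> y; exact: powR_ge0.
  - exact: measurable_funM (measurable_cst _) mF.
  - exact: measurable_local_powB.
  - exact: measurable_japanese_powR.
  - exact: measurable_japaneseB_powR.
  - by move=> y; exact: majorant_pointwise.
  - exact: hA.
  - by under eq_integral do rewrite -japanese0B; exact: hB.
  - exact: hB.
move: iF mF F0; set c := _ `^ d in Xd0 *.
set F := fun y => _ * majorant (x - y) => iF mF F0.
have -> : (6 * A + 12 * (B + B)) * japanese x `^ (- d) =
  c^-1 * (6 * A + 12 * (B + B)) by rewrite mulrC powRN.
have -> : (\int[leb2]_y (F y)%:E = \int[leb2]_y (c^-1 * (c * F y))%:E)%E.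
  by apply: eq_integral => y _; rewrite mulrA mulVf ?mul1r// gt_eqF.
apply: ge0_le_integralZ iF.
- by rewrite invr_ge0 ltW.
- by move=> y; rewrite mulr_ge0// ltW.
- exact: measurable_funM (measurable_cst _) mF.
Qed.

End Potential.

(** * Norms of complex numbers and spinors *)
Section ComplexNorm.
Context {R : realType}.
Local Notation normc := (@ComplexField.Normc.normc R).
Implicit Types z w : R[i].

Lemma normc_normE z : `|z| = (normc z)%:C.
Proof. by []. Qed.

Lemma normc_ge0 z : 0 <= normc z.
Proof. by case: z => a b; exact: sqrtr_ge0. Qed.

Lemma normcD_le z w : normc (z + w) <= normc z + normc w.
Proof. by have := ler_normD z w; rewrite !normc_normE -rmorphD lecR. Qed.

Lemma normc_conj z : normc (Num.conj z) = normc z.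
Proof. by have /complexI := norm_conjC z. Qed.

Lemma normc_real (a : R) : normc a%:C = `|a|.
Proof. by rewrite /= expr0n addr0 sqrtr_sqr. Qed.

Lemma abs_Re_le z : `|complex.Re z| <= normc z.
Proof. by case: z => a b /=; rewrite -sqrtr_sqr ler_wsqrtr// lerDl sqr_ge0. Qed.

Lemma abs_Im_le z : `|complex.Im z| <= normc z.
Proof. by case: z => a b /=; rewrite -sqrtr_sqr ler_wsqrtr// lerDr sqr_ge0. Qed.

Lemma normc_le_ReIm z : normc z <= `|complex.Re z| + `|complex.Im z|.
Proof.
case: z => a b /=.
rewrite -(ler_pXn2r (ltn0Sn 1)) ?nnegrE ?sqrtr_ge0 ?addr_ge0//.
rewrite sqr_sqrtr ?addr_ge0 ?sqr_ge0// sqrrD !real_normK ?num_real//.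
by rewrite lerD2r lerDl mulrn_wge0// mulr_ge0.
Qed.

Lemma ReM z w : complex.Re (z * w) =
  complex.Re z * complex.Re w - complex.Im z * complex.Im w.
Proof. by case: z; case: w. Qed.

Lemma ImM z w : complex.Im (z * w) =
  complex.Re z * complex.Im w + complex.Im z * complex.Re w.
Proof. by case: z; case: w. Qed.

Lemma ReD z w : complex.Re (z + w) = complex.Re z + complex.Re w.
Proof. by case: z; case: w. Qed.

Lemma ImD z w : complex.Im (z + w) = complex.Im z + complex.Im w.
Proof. by case: z; case: w. Qed.

End ComplexNorm.

Section SpinorNorm.
Context {R : realType}.
Local Notation normc := (@ComplexField.Normc.normc R).
Implicit Types (a b : 'cV[R[i]]_2) (M N : 'M[R[i]]_2).

(** Case analysis that leaves the two indices as [0] and [1] instead of raw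
    ordinals. *)
Lemma ord2P (P : 'I_2 -> Prop) : P 0 -> P 1 -> forall i, P i.
Proof.
move=> P0 P1 [[|[|//]] hi].
  by rewrite (_ : Ordinal _ = 0)//; exact/val_inj.
by rewrite (_ : Ordinal _ = 1)//; exact/val_inj.
Qed.

Lemma big_ord2 (T : nmodType) (F : 'I_2 -> T) : \sum_(i < 2) F i = F 0 + F 1.
Proof.
by rewrite !big_ord_recl big_ord0 addr0; congr (F _ + F _); exact/val_inj.
Qed.

Lemma spinor_normE a :
  spinor_norm a = Num.sqrt (normc (a 0 0) ^+ 2 + normc (a 1 0) ^+ 2).
Proof. by rewrite /spinor_norm big_ord2. Qed.

Lemma spinor_norm_ge0 a : 0 <= spinor_norm a.
Proof. exact: sqrtr_ge0. Qed.

Lemma normc_le_spinor_norm a i : normc (a i 0) <= spinor_norm a.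
Proof.
rewrite spinor_normE -[leLHS](ger0_norm (normc_ge0 _)) -sqrtr_sqr.
by apply: ler_wsqrtr; move: i; apply: ord2P; rewrite ?lerDl ?lerDr sqr_ge0.
Qed.

Lemma spinor_norm_le_sum a : spinor_norm a <= normc (a 0 0) + normc (a 1 0).
Proof.
rewrite spinor_normE.
have u0 := normc_ge0 (a 0 0); have v0 := normc_ge0 (a 1 0).
rewrite -(ler_pXn2r (ltn0Sn 1)) ?nnegrE ?sqrtr_ge0 ?addr_ge0//.
rewrite sqr_sqrtr ?addr_ge0 ?sqr_ge0// sqrrD.
by rewrite lerD2r lerDl mulrn_wge0// mulr_ge0.
Qed.

Lemma spinor_normZ (c : R[i]) a :
  spinor_norm (c *: a) = normc c * spinor_norm a.
Proof.
rewrite !spinor_normE !mxE !ComplexField.Normc.normcM !exprMn -mulrDr.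
by rewrite sqrtrM ?sqr_ge0// sqrtr_sqr ger0_norm// normc_ge0.
Qed.

Lemma alpha_dotE (x : plane R) :
  alpha_dot x = mx2 0 (x.1 -i* x.2) (x.1 +i* x.2) 0.
Proof.
apply/matrixP => i j; rewrite /alpha_dot /alpha1 /alpha2 !mxE.
by move: i; apply: ord2P => /=; move: j; apply: ord2P => /=; simpc.
Qed.

(** alpha.x is antidiagonal with entries x_1 -+ i x_2, both of modulus |x|; in
    other words alpha.x / |x| is unitary. *)
Lemma spinor_norm_alpha_dot (x : plane R) a :
  spinor_norm (alpha_dot x *m a) = enorm2 x * spinor_norm a.
Proof.
have E1 : (alpha_dot x *m a) 0 0 = (x.1 -i* x.2) * a 1 0.
  by rewrite alpha_dotE mxE big_ord2 !mxE /= mul0r add0r.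
have E2 : (alpha_dot x *m a) 1 0 = (x.1 +i* x.2) * a 0 0.
  by rewrite alpha_dotE mxE big_ord2 !mxE /= mul0r addr0.
rewrite !spinor_normE E1 E2 !ComplexField.Normc.normcM /= sqrrN !exprMn -mulrDr.
rewrite sqrtrM ?sqr_ge0// sqrtr_sqr ger0_norm ?sqrtr_ge0//.
by rewrite [in RHS]addrC.
Qed.

Lemma mulmx_entry_le m n (A : 'M[R[i]]_(m, 2)) (B : 'M[R[i]]_(2, n))
    (p q : R) i j :
  0 <= p -> (forall k, normc (A i k) <= p) -> (forall k, normc (B k j) <= q) ->
  normc ((A *m B) i j) <= 2 * (p * q).
Proof.
move=> p0 hA hB; rewrite mxE big_ord2.
apply: le_trans (normcD_le _ _) _.
rewrite !ComplexField.Normc.normcM mulr2n mulrDl mul1r.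
by apply: lerD; apply: ler_pM; rewrite ?normc_ge0.
Qed.

Lemma spinor_norm_mulmx_le M a (c : R) : (forall i j, normc (M i j) <= c) ->
  spinor_norm (M *m a) <= 4 * c * spinor_norm a.
Proof.
move=> hM; have c0 : 0 <= c := le_trans (normc_ge0 _) (hM 0 0).
have h i : normc ((M *m a) i 0) <= 2 * (c * spinor_norm a).
  by apply: mulmx_entry_le => // k; exact: normc_le_spinor_norm.
apply: le_trans (spinor_norm_le_sum _) _.
have := lerD (h 0) (h 1); congr (_ <= _); ring.
Qed.

Lemma unitary_entry_le1 M i j : M \is unitarymx -> normc (M i j) <= 1.
Proof.
move=> /unitarymxP/matrixP/(_ i i); rewrite !mxE eqxx big_ord2 !mxE -!normCK.
rewrite !normc_normE -!rmorphXn -rmorphD => /complexI s1.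
have : normc (M i j) ^+ 2 <= 1.
  rewrite -s1; move: j; apply: ord2P; rewrite ?lerDl ?lerDr; exact: sqr_ge0.
by rewrite expr_le1 ?normc_ge0.
Qed.

End SpinorNorm.

(** * The factorization V = v^* U v *)
Section Potential_factorization.
Context {R : realType}.
Local Notation normc := (@ComplexField.Normc.normc R).
Context (V B : matrix_field R) (zeta : 'I_2 -> plane R -> R) (x : plane R).
Context (Bu : B x \is unitarymx).
Context (VE : V x = (B x)^t* *m diag_mx (\row_j (zeta j x)%:C) *m B x).

(** The eigenvalues are the diagonal entries of B V B^*, and the entries of the
    unitary matrix B are at most 1 in modulus. *)
Lemma eigenvalue_le (c : R) : 0 <= c ->
  (forall i j, normc (V x i j) <= c) -> forall k, `|zeta k x| <= 4 * c.
Proof.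
move=> c0 hV k.
have Buu : B x *m (B x)^t* = 1%:M by exact/unitarymxP.
have D : diag_mx (\row_j (zeta j x)%:C) = B x *m V x *m (B x)^t*.
  by rewrite VE -!mulmxA Buu mulmx1 !mulmxA Buu mul1mx.
have := congr1 (fun M : 'M[R[i]]_2 => normc (M k k)) D.
rewrite mxE mxE eqxx mulr1n normc_real => ->.
have -> : 4 * c = 2 * (2 * (1 * c) * 1) by ring.
apply: mulmx_entry_le; first by rewrite !mulr_ge0.
  move=> l; apply: mulmx_entry_le => // m; exact: unitary_entry_le1.
by move=> l; rewrite !mxE normc_conj unitary_entry_le1.
Qed.

Lemma v_adj_entry_le (c : R) : (forall k, `|zeta k x| <= c) ->
  forall i j, normc (((v_of B zeta x)^t*) i j) <= Num.sqrt c.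
Proof.
move=> hz i j; rewrite mxE mxE normc_conj /v_of mul_diag_mx !mxE.
rewrite ComplexField.Normc.normcM normc_real ger0_norm ?sqrtr_ge0//.
rewrite -[leRHS]mulr1 ler_pM ?sqrtr_ge0 ?normc_ge0 ?unitary_entry_le1//.
by rewrite ler_wsqrtr.
Qed.

Lemma U_ofK : U_of zeta x *m U_of zeta x = 1%:M.
Proof.
rewrite /U_of mulmx_diag; apply/matrixP => i j; rewrite !mxE.
by case: ifP => _; rewrite ?mulrNN mulr1.
Qed.

(** On each eigenvalue, |z|^(1/2) sign(z) |z|^(1/2) = z. *)
Lemma v_adj_U_v : (v_of B zeta x)^t* *m U_of zeta x *m v_of B zeta x = V x.
Proof.
rewrite VE /v_of /U_of trmx_mul map_mxM -!mulmxA; congr (_ *m _).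
rewrite !mulmxA; congr (_ *m _).
rewrite tr_diag_mx map_diag_mx !mulmx_diag; congr diag_mx.
apply/rowP => j; rewrite !mxE.
rewrite /= conj_Creal; last first.
  by apply/complex_realP; exists (Num.sqrt `|zeta j x|).
rewrite mulrAC -rmorphM -expr2 sqr_sqrtr//.
have [z0|z0] := ltP (zeta j x) 0; last by rewrite mulr1 ger0_norm.
by rewrite ltr0_norm// mulrN1 rmorphN opprK.
Qed.

End Potential_factorization.

(** * Measurability and integration of spinor fields *)
Section Measurability.
Context {R : realType}.

(** The notions of measurability used for fields on the plane, over an arbitrary
    domain: the kernels are functions of two points of the plane. *)
Definition cmeasurable d (T : measurableType d) (g : T -> R[i]) : Prop :=
  measurable_fun setT (fun t => complex.Re (g t) : R) /\
  measurable_fun setT (fun t => complex.Im (g t) : R).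

Definition mxmeasurable d (T : measurableType d) m n
    (F : T -> 'M[R[i]]_(m, n)) : Prop :=
  forall i j, cmeasurable (fun t => F t i j).

Section Generic.
Context d (T : measurableType d).
Implicit Types (f g : T -> R[i]).

Lemma cmeasurable_cst (c : R[i]) : cmeasurable (fun _ : T => c).
Proof. by split; exact: measurable_cst. Qed.

Lemma cmeasurable_real (r : T -> R) : measurable_fun setT r ->
  cmeasurable (fun t => (r t)%:C).
Proof. by split => //; exact: measurable_cst. Qed.

Lemma cmeasurableD f g : cmeasurable f -> cmeasurable g ->
  cmeasurable (fun t => f t + g t).
Proof.
move=> [fr fi] [gr gi]; split.
- by under eq_fun do rewrite ReD; exact: measurable_funD.
- by under eq_fun do rewrite ImD; exact: measurable_funD.
Qed.

Lemma cmeasurableM f g : cmeasurable f -> cmeasurable g ->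
  cmeasurable (fun t => f t * g t).
Proof.
move=> [fr fi] [gr gi]; split.
- under eq_fun do rewrite ReM; apply: measurable_funB; exact: measurable_funM.
- under eq_fun do rewrite ImM; apply: measurable_funD; exact: measurable_funM.
Qed.

Lemma cmeasurable_conj f : cmeasurable f ->
  cmeasurable (fun t => Num.conj (f t)).
Proof.
move=> [fr fi]; split.
- by apply: (eq_measurable_fun _ _ fr) => t _; case: (f t).
- apply: (eq_measurable_fun (fun t => - complex.Im (f t))).
    by move=> t _; case: (f t).
  exact: measurable_funN.
Qed.

Lemma measurable_normc f : cmeasurable f ->
  measurable_fun setT (fun t => ComplexField.Normc.normc (f t)).
Proof.
move=> [fr fi].
apply: (eq_measurable_fun
  (fun t => Num.sqrt (complex.Re (f t) ^+ 2 + complex.Im (f t) ^+ 2))).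
  by move=> t _; case: (f t).
apply: measurable_sqrt_comp; first by move=> t; rewrite addr_ge0 ?sqr_ge0.
by apply: measurable_funD; exact: measurable_funX.
Qed.

Lemma mxmeasurableM m n (A : T -> 'M[R[i]]_(m, 2)) (B : T -> 'M[R[i]]_(2, n)) :
  mxmeasurable A -> mxmeasurable B -> mxmeasurable (fun t => A t *m B t).
Proof.
move=> mA mB i j.
have := cmeasurableD (cmeasurableM (mA i 0) (mB 0 j))
  (cmeasurableM (mA i 1) (mB 1 j)).
by congr cmeasurable; apply/funext => t; rewrite mxE big_ord2.
Qed.

Lemma mxmeasurableZ m n (c : T -> R[i]) (A : T -> 'M[R[i]]_(m, n)) :
  cmeasurable c -> mxmeasurable A -> mxmeasurable (fun t => c t *: A t).
Proof.
move=> mc mA i j; have := cmeasurableM mc (mA i j).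
by congr cmeasurable; apply/funext => t; rewrite mxE.
Qed.

Lemma mxmeasurableD m n (A B : T -> 'M[R[i]]_(m, n)) :
  mxmeasurable A -> mxmeasurable B -> mxmeasurable (fun t => A t + B t).
Proof.
move=> mA mB i j; have := cmeasurableD (mA i j) (mB i j).
by congr cmeasurable; apply/funext => t; rewrite mxE.
Qed.

Lemma mxmeasurable_cst m n (A : 'M[R[i]]_(m, n)) :
  mxmeasurable (fun _ : T => A).
Proof. by move=> i j; exact: cmeasurable_cst. Qed.

Lemma measurable_spinor_norm (f : T -> 'cV[R[i]]_2) : mxmeasurable f ->
  measurable_fun setT (fun t => spinor_norm (f t)).
Proof.
move=> mf; under eq_fun do rewrite spinor_normE.
apply: measurable_sqrt_comp; first by move=> t; rewrite addr_ge0 ?sqr_ge0.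
by apply: measurable_funD; apply: measurable_funX; exact: measurable_normc.
Qed.

Lemma mxmeasurable_alpha_dot (f : T -> plane R) : measurable_fun setT f ->
  mxmeasurable (fun t => alpha_dot (f t)).
Proof.
move=> mf.
apply: mxmeasurableD; apply: mxmeasurableZ; try exact: mxmeasurable_cst.
- by apply: cmeasurable_real; exact: measurableT_comp.
- by apply: cmeasurable_real; exact: measurableT_comp.
Qed.

End Generic.
End Measurability.

Section SpinorIntegral.
Context {R : realType}.
Local Notation normc := (@ComplexField.Normc.normc R).

(** No integrability is assumed: the positive and negative parts have measurable
    partial integrals by Tonelli, and [fine] is measurable. *)
Lemma measurable_Rintegral_leb2 (g : plane R * plane R -> R) :
  measurable_fun setT g ->
  measurable_fun setT (fun x => Rintegral leb2 setT (fun y => g (x, y))).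
Proof.
move=> mg; apply: (measurableT_comp (fine_measurable measurableT)).
pose f (p : plane R * plane R) := (g p)%:E.
have mf : measurable_fun setT f by exact/measurable_EFinP.
rewrite (_ : (fun x => _) = (fun x => \int[leb2]_y f^\+ (x, y) -
    \int[leb2]_y f^\- (x, y))%E); last first.
  apply/funext => x; rewrite integralE; congr (_ - _)%E;
    apply: eq_integral => y _; by rewrite ?funeposE ?funenegE.
apply: emeasurable_funB.
- exact: measurable_integral_leb2 (measurable_funepos mf) (funepos_ge0 _).
- exact: measurable_integral_leb2 (measurable_funeneg mf) (funeneg_ge0 _).
Qed.

Lemma mxmeasurable_spinor_integral (F : plane R * plane R -> 'cV[R[i]]_2) :
  mxmeasurable F ->
  mx_measurable (fun x => spinor_integral (fun y => F (x, y))).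
Proof.
move=> mF i j; have [fr fi] := mF i 0.
split; under eq_fun do rewrite mxE /=.
- exact: measurable_Rintegral_leb2 fr.
- exact: measurable_Rintegral_leb2 fi.
Qed.

Lemma abs_Rintegral_le (g : plane R -> R) (k : plane R -> R) :
  measurable_fun setT g -> measurable_fun setT k -> (forall y, `|g y| <= k y) ->
  (`|Rintegral leb2 setT g|%:E <= \int[leb2]_y (k y)%:E)%E.
Proof.
move=> mg mk gk.
have abs_fine (e : \bar R) : (`|fine e|%:E <= `|e|)%E.
  by case: e => [r| |]; rewrite /= ?normr0 ?lexx ?leey.
apply: le_trans (abs_fine _) _.
apply: le_trans (le_abse_integral _ _ _) _ => //; first exact/measurable_EFinP.
apply: ge0_le_integral => //.
- by apply: measurableT_comp => //; exact/measurable_EFinP.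
- exact/measurable_EFinP.
- by move=> y _; rewrite lee_fin.
Qed.

(** The factor 4 counts the real and imaginary parts of two components.  When
    the right-hand side is infinite the statement is void, so it can be used
    before integrability is known. *)
Lemma spinor_norm_integral_le (f : spinor_field R) : mx_measurable f ->
  ((spinor_norm (spinor_integral f))%:E <=
    4%:E * \int[leb2]_y (spinor_norm (f y))%:E)%E.
Proof.
move=> mf; set J := integral _ _ _.
have mN : measurable_fun setT (fun y => spinor_norm (f y)).
  exact: measurable_spinor_norm.
have J0 : (0 <= J)%E.
  by apply: integral_ge0 => y _; rewrite lee_fin spinor_norm_ge0.
have hc i : ((normc (spinor_integral f i 0))%:E <= J + J)%E.
  have [fr fi] := mf i 0; rewrite mxE.
  apply: (@le_trans _ _
    (`|Rintegral leb2 setT (fun y => complex.Re (f y i 0))|%:E +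
     `|Rintegral leb2 setT (fun y => complex.Im (f y i 0))|%:E)%E).
    by rewrite -EFinD lee_fin; exact: normc_le_ReIm.
  apply: leeD; apply: abs_Rintegral_le => // y.
  - exact: le_trans (abs_Re_le _) (normc_le_spinor_norm _ _).
  - exact: le_trans (abs_Im_le _) (normc_le_spinor_norm _ _).
apply: (@le_trans _ _ ((normc (spinor_integral f 0 0))%:E +
                       (normc (spinor_integral f 1 0))%:E)%E).
  by rewrite -EFinD lee_fin spinor_norm_le_sum.
apply: le_trans (leeD (hc 0) (hc 1)) _.
case: J J0 {hc} => [r _| _|//]; last by rewrite mulry gtr0_sg// mul1e leey.
by rewrite -!EFinD -EFinM lee_fin; lra.
Qed.

Definition spinor_integrable (f : spinor_field R) : Prop :=
  mx_measurable f /\ (\int[leb2]_y (spinor_norm (f y))%:E < +oo)%E.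

Definition cintegrable (g : plane R -> R[i]) : Prop :=
  leb2.-integrable setT (fun y => (complex.Re (g y))%:E) /\
  leb2.-integrable setT (fun y => (complex.Im (g y))%:E).

Lemma spinor_integrableP (f : spinor_field R) i : spinor_integrable f ->
  cintegrable (fun y => f y i 0).
Proof.
move=> [mf fi]; have [fr fim] := mf i 0.
have mN : measurable_fun setT (fun y => (spinor_norm (f y))%:E).
  by apply/measurable_EFinP; exact: measurable_spinor_norm.
have H (g : plane R -> R) : measurable_fun setT g ->
    (forall y, `|g y| <= spinor_norm (f y)) ->
    leb2.-integrable setT (fun y => (g y)%:E).
  move=> mg gf; apply/integrableP; split; first exact/measurable_EFinP.
  apply: le_lt_trans fi; apply: ge0_le_integral => //.
  - by apply: measurableT_comp => //; exact/measurable_EFinP.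
  - by move=> y _; rewrite lee_fin.
split; apply: H => // y.
- exact: le_trans (abs_Re_le _) (normc_le_spinor_norm _ _).
- exact: le_trans (abs_Im_le _) (normc_le_spinor_norm _ _).
Qed.

Lemma cintegrableZ (c : R[i]) g : cintegrable g ->
  cintegrable (fun y => c * g y).
Proof.
move=> [gr gi]; split.
- under eq_fun do rewrite ReM EFinB !EFinM.
  by apply: integrableB => //; exact: integrableZl.
- under eq_fun do rewrite ImM EFinD !EFinM.
  by apply: integrableD => //; exact: integrableZl.
Qed.

Lemma complex_integralD g1 g2 : cintegrable g1 -> cintegrable g2 ->
  complex_integral leb2 setT (fun y => g1 y + g2 y) =
  complex_integral leb2 setT g1 + complex_integral leb2 setT g2.
Proof.
move=> [r1 i1] [r2 i2]; rewrite /complex_integral.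
under [in X in X +i* _]eq_Rintegral do rewrite ReD.
under [in X in _ +i* X]eq_Rintegral do rewrite ImD.
by rewrite !RintegralD//; simpc.
Qed.

Lemma complex_integralZ (c : R[i]) g : cintegrable g ->
  complex_integral leb2 setT (fun y => c * g y) =
  c * complex_integral leb2 setT g.
Proof.
move=> [gr gi]; rewrite /complex_integral.
under [in X in X +i* _]eq_Rintegral do rewrite ReM.
under [in X in _ +i* X]eq_Rintegral do rewrite ImM.
have Z r (k : plane R -> R) : leb2.-integrable setT (fun y => (k y)%:E) ->
    leb2.-integrable setT (fun y => (r * k y)%:E).
  by move=> ik; under eq_fun do rewrite EFinM; exact: integrableZl.
rewrite RintegralB//; [|exact: Z..].
rewrite RintegralD//; [|exact: Z..].
by rewrite !RintegralZl//; case: c => a b; simpc.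
Qed.

Lemma spinor_integralD f g : spinor_integrable f -> spinor_integrable g ->
  spinor_integral (fun y => f y + g y) = spinor_integral f + spinor_integral g.
Proof.
move=> fi gi; apply/colP => i; rewrite !mxE -complex_integralD.
- by congr complex_integral; apply/funext => y; rewrite mxE.
- exact: spinor_integrableP.
- exact: spinor_integrableP.
Qed.

Lemma spinor_integral_mulmx (M : 'M[R[i]]_2) f : spinor_integrable f ->
  spinor_integral (fun y => M *m f y) = M *m spinor_integral f.
Proof.
move=> fi; apply/colP => i; rewrite mxE [RHS]mxE big_ord2 !mxE.
rewrite -!complex_integralZ; [|exact: spinor_integrableP..].
rewrite -complex_integralD; [|exact/cintegrableZ/spinor_integrableP..].
by congr complex_integral; apply/funext => y; rewrite mxE big_ord2.
Qed.

End SpinorIntegral.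

(** * The kernel of G00 and its difference with the leading term *)
Section Kernel.
Context {R : realType}.
Local Notation normc := (@ComplexField.Normc.normc R).
Implicit Types x y : plane R.

Lemma twopi_ge1 : 1 <= 2 * pi :> R.
Proof. by have := @pi_ge2 R; lra. Qed.

Lemma twopi_gt0 : 0 < 2 * pi :> R.
Proof. exact: lt_le_trans twopi_ge1. Qed.

Lemma real_complex_inv (a : R) : (a%:C)^-1 = (a^-1)%:C :> R[i].
Proof. by rewrite fmorphV. Qed.

(** Separates the real size of the coefficient from the factor i. *)
Lemma dipole_coefE (a : R) :
  'i / (2 * pi * a)%:C = ((2 * pi)^-1 * a^-1)%:C * 'i :> R[i].
Proof. by rewrite real_complex_inv invfM mulrC. Qed.

Lemma normc_i : normc 'i = 1.
Proof. by rewrite /= expr0n expr1n add0r sqrtr1. Qed.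

(** Holds at [r = 0] as well, both sides being 0. *)
Lemma inv_sqrM (c r : R) : c * (r ^+ 2)^-1 * r = c * r^-1.
Proof.
have [->|r0] := eqVneq r 0; first by rewrite invr0 !mulr0.
by field.
Qed.

Lemma spinor_norm_G00_kernel x y (a : 'cV[R[i]]_2) :
  spinor_norm (G00_kernel x y *m a) <= (enorm2 (x - y))^-1 * spinor_norm a.
Proof.
rewrite /G00_kernel dipole_coefE -scalemxAl spinor_normZ spinor_norm_alpha_dot.
rewrite ComplexField.Normc.normcM normc_i mulr1 normc_real ger0_norm; last first.
  by rewrite mulr_ge0 ?invr_ge0 ?sqr_ge0// ltW// twopi_gt0.
rewrite mulrA ler_wpM2r ?spinor_norm_ge0// inv_sqrM.
by rewrite ler_piMl ?invr_ge0 ?enorm2_ge0// invf_le1 ?twopi_gt0// twopi_ge1.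
Qed.

Lemma mxmeasurable_dipole d (T : measurableType d) (r : T -> R)
    (z : T -> plane R) :
  (forall t, 0 <= r t) -> measurable_fun setT r -> measurable_fun setT z ->
  mxmeasurable (fun t => ('i / (2 * pi * r t)%:C) *: alpha_dot (z t)).
Proof.
move=> r0 mr mz; apply: mxmeasurableZ; last exact: mxmeasurable_alpha_dot.
rewrite (_ : (fun t => _) = fun t => ((2 * pi)^-1 * (r t)^-1)%:C * 'i); last first.
  by apply/funext => t; rewrite dipole_coefE.
apply: cmeasurableM; last exact: cmeasurable_cst.
apply: cmeasurable_real; apply: measurable_funM; first exact: measurable_cst.
exact: measurable_inv_comp.
Qed.

Lemma mxmeasurable_G00_kernel d (T : measurableType d) (f g : T -> plane R) :
  measurable_fun setT f -> measurable_fun setT g ->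
  mxmeasurable (fun t => G00_kernel (f t) (g t)).
Proof.
move=> mf mg; apply: mxmeasurable_dipole.
- by move=> t; exact: sqr_ge0.
- by apply: measurable_funX; exact: measurable_enorm2B.
- by apply: measurable_fun_pair => /=; apply: measurable_funB;
     exact: measurableT_comp.
Qed.

Lemma measurable_G00 (f : spinor_field R) : mx_measurable f ->
  mx_measurable (G00 f).
Proof.
move=> mf; apply: (mxmeasurable_spinor_integral
  (F := fun p => G00_kernel p.1 p.2 *m f p.2)).
apply: mxmeasurableM; first exact: mxmeasurable_G00_kernel.
move=> i j; have [fr fi] := mf i j.
by split; [exact: (measurableT_comp fr)|exact: (measurableT_comp fi)].
Qed.

Lemma mx_measurable_G00_integrand (f : spinor_field R) x : mx_measurable f ->
  mx_measurable (fun y => G00_kernel x y *m f y).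
Proof.
move=> mf; apply: (mxmeasurableM (A := G00_kernel x)) mf.
exact: mxmeasurable_G00_kernel.
Qed.

Lemma measurable_inv_enorm2B (f : spinor_field R) x : mx_measurable f ->
  measurable_fun setT (fun y => (enorm2 (x - y))^-1 * spinor_norm (f y)).
Proof.
move=> mf; apply: measurable_funM; last exact: measurable_spinor_norm.
apply: measurable_inv_comp; first by move=> y; exact: enorm2_ge0.
exact: measurable_enorm2B.
Qed.

Lemma integral_G00_kernel_le (f : spinor_field R) x : mx_measurable f ->
  (\int[leb2]_y (spinor_norm (G00_kernel x y *m f y))%:E <=
   \int[leb2]_y ((enorm2 (x - y))^-1 * spinor_norm (f y))%:E)%E.
Proof.
move=> mf; apply: ge0_le_integral.
- exact: measurableT.
- by move=> y _; rewrite lee_fin spinor_norm_ge0.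
- apply/measurable_EFinP/measurable_spinor_norm.
  exact: mx_measurable_G00_integrand.
- by apply/measurable_EFinP; exact: measurable_inv_enorm2B.
- by move=> y _; rewrite lee_fin; exact: spinor_norm_G00_kernel.
Qed.

Lemma spinor_norm_G00_le (f : spinor_field R) x : mx_measurable f ->
  ((spinor_norm (G00 f x))%:E <=
   4%:E * \int[leb2]_y ((enorm2 (x - y))^-1 * spinor_norm (f y))%:E)%E.
Proof.
move=> mf.
apply: le_trans (spinor_norm_integral_le (mx_measurable_G00_integrand x mf)) _.
by apply: lee_wpmul2l; rewrite ?lee_fin//; exact: integral_G00_kernel_le.
Qed.

(** The vector w with alpha.w the difference of the two kernels, up to the
    factor i / (2 pi). *)
Definition dipole_shift x y : plane R :=
  ((x - y).1 * (enorm2 (x - y) ^+ 2)^-1 - x.1 * (japanese x ^+ 2)^-1,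
   (x - y).2 * (enorm2 (x - y) ^+ 2)^-1 - x.2 * (japanese x ^+ 2)^-1).

(** Outside the unit disc <z>^2 <= 2 |z|^2, so the constant 3 is ample. *)
Lemma inv_enorm2_le_majorant x : (enorm2 x)^-1 <= majorant x.
Proof.
rewrite /majorant /local_pow; case: ifPn => [x1|].
  apply: ler_wpDr; first by rewrite mulr_ge0 ?invr_ge0 ?japanese_ge0.
  have [->|x0] := eqVneq (enorm2 x) 0; first by rewrite invr0 powR_ge0.
  rewrite -powR_inv1 ?enorm2_ge0//; apply: ger_powR; last by rewrite lerN2; lra.
  by rewrite lt_neqAle eq_sym x0 enorm2_ge0 ltW.
rewrite -leNgt add0r => x1.
rewrite -[leLHS]mul1r ler_pdivrMr ?(lt_le_trans _ x1)//.
rewrite mulrAC ler_pdivlMr ?japanese_gt0// mul1r.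
rewrite -(ler_pXn2r (ltn0Sn 1)) ?nnegrE ?mulr_ge0 ?enorm2_ge0 ?japanese_ge0//.
rewrite japanese_sqr exprMn; have : 1 <= enorm2 x ^+ 2 by rewrite exprn_ege1.
lra.
Qed.

(** With (p, q) = x - y, (a, b) = x, i = 1 / |x - y|^2 and k = 1 / <x>^2 the
    left-hand side is |w|^2 and the right-hand side is
    <y>^2 / (<x>^2 |x - y|^2).  Expanding both, they differ by exactly k^2. *)
Lemma shift_sqr_le (p q a b i k : R) : 0 <= k ->
  (p ^+ 2 + q ^+ 2) * i = 1 -> (1 + (a ^+ 2 + b ^+ 2)) * k = 1 ->
  (p * i - a * k) ^+ 2 + (q * i - b * k) ^+ 2 <=
  k * (1 + ((a - p) ^+ 2 + (b - q) ^+ 2)) * i.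
Proof.
move=> k0 hi hk.
have -> : (p * i - a * k) ^+ 2 + (q * i - b * k) ^+ 2 =
  ((p ^+ 2 + q ^+ 2) * i) * i - 2 * (p * a + q * b) * i * k +
  ((1 + (a ^+ 2 + b ^+ 2)) * k) * k - k ^+ 2 by ring.
have -> : k * (1 + ((a - p) ^+ 2 + (b - q) ^+ 2)) * i =
  ((1 + (a ^+ 2 + b ^+ 2)) * k) * i - 2 * (p * a + q * b) * i * k +
  ((p ^+ 2 + q ^+ 2) * i) * k by ring.
by rewrite hi hk; have := sqr_ge0 k; lra.
Qed.

(** Off the diagonal this is [shift_sqr_le].  On the diagonal w is - x / <x>^2,
    of length at most 1 / <x>, and the majorant is at least 1. *)
Lemma dipole_shift_le x y :
  enorm2 (dipole_shift x y) <=
  (japanese x)^-1 * (japanese y * majorant (x - y)).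
Proof.
have X1 := japanese_ge1 x; have Y1 := japanese_ge1 y.
have X0 := japanese_gt0 x.
have Xi0 : 0 <= (japanese x)^-1 by rewrite invr_ge0 ltW.
have hk : (1 + (x.1 ^+ 2 + x.2 ^+ 2)) * (japanese x ^+ 2)^-1 = 1.
  by rewrite -enorm2_sqr -japanese_sqr mulfV// expf_neq0// gt_eqF.
have k0 : 0 <= (japanese x ^+ 2)^-1 by rewrite invr_ge0 sqr_ge0.
have [r0|r0] := eqVneq (enorm2 (x - y)) 0.
  have xy : x - y = 0 by exact: enorm2_eq0.
  apply: (@le_trans _ _ (japanese x)^-1).
    apply: enorm2_le => //.
    rewrite /dipole_shift xy /= !mul0r !sub0r !sqrrN !exprMn -mulrDl [leRHS]exprVn.
    move: hk k0; set k := (_ ^+ 2)^-1; set e := x.1 ^+ 2 + x.2 ^+ 2 => hk k0.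
    have -> : e * k ^+ 2 = ((1 + e) * k) * k - k ^+ 2 by ring.
    by rewrite hk mul1r gerBl sqr_ge0.
  rewrite ler_peMr// (le_trans Y1)// ler_peMr ?japanese_ge0// xy /majorant.
  apply: ler_wpDl; first exact: local_pow_ge0.
  rewrite (_ : japanese 0 = 1) ?invr1; last first.
    by rewrite /japanese /enorm2 /= expr0n /= !addr0 sqrtr0 expr0n /= addr0 sqrtr1.
  lra.
apply: (@le_trans _ _ ((japanese x)^-1 * (japanese y * (enorm2 (x - y))^-1))).
  apply: enorm2_le.
    by rewrite !mulr_ge0 ?invr_ge0 ?enorm2_ge0 ?japanese_ge0.
  have hi : ((x - y).1 ^+ 2 + (x - y).2 ^+ 2) * (enorm2 (x - y) ^+ 2)^-1 = 1.
    by rewrite -enorm2_sqr mulfV// expf_neq0.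
  have := shift_sqr_le k0 hi hk.
  congr (_ <= _); rewrite !exprMn !exprVn mulrA; congr (_ * _ * _).
  by rewrite japanese_sqr enorm2_sqr /=; ring.
apply: (ler_wpM2l Xi0); apply: (ler_wpM2l (japanese_ge0 y)).
exact: inv_enorm2_le_majorant.
Qed.

End Kernel.

(** * Membership in L^2 and in L^oo *)
Section Lp.
Context {R : realType}.
Implicit Types f : spinor_field R.

Lemma integral_sqr_normE f :
  (\int[leb2]_x (`|(spinor_norm (f x))%:E| `^ 2) =
   \int[leb2]_x (spinor_norm (f x) ^+ 2)%:E)%E.
Proof.
apply: eq_integral => x _.
rewrite gee0_abs ?lee_fin ?spinor_norm_ge0// poweR_EFin.
by rewrite -powR_mulrn ?spinor_norm_ge0.
Qed.

Lemma in_L2_integral f : in_Lp 2%:E f -> exists2 N : R, 0 <= N &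
  (\int[leb2]_x (spinor_norm (f x) ^+ 2)%:E <= N%:E)%E.
Proof.
move=> [_]; rewrite /finite_norm => fN.
have I0 : (0 <= \int[leb2]_x (spinor_norm (f x) ^+ 2)%:E)%E.
  by apply: integral_ge0 => x _; rewrite lee_fin sqr_ge0.
have : (\int[leb2]_x (spinor_norm (f x) ^+ 2)%:E < +oo)%E.
  rewrite -integral_sqr_normE.
  rewrite -(powR_Lnorm leb2 (EFin \o (fun x => spinor_norm (f x)))) ?pnatr_eq0//.
  exact: poweR_lty.
move: I0; case: (integral _ _ _) => [r r0 _|//|//].
by exists r; rewrite -?lee_fin.
Qed.

Lemma in_L2_of_integral f (N : R) : mx_measurable f ->
  (\int[leb2]_x (spinor_norm (f x) ^+ 2)%:E <= N%:E)%E -> in_Lp 2%:E f.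
Proof.
move=> mf fN; split => //; rewrite /finite_norm unlock /Lnorm poweR_lty//.
by rewrite integral_sqr_normE (le_lt_trans fN)// ltry.
Qed.

Lemma in_Loo_of_bounded f (C : R) : mx_measurable f ->
  (forall x, spinor_norm (f x) <= C) -> in_Lp +oo%E f.
Proof.
move=> mf fC; split => //; rewrite /finite_norm unlock /Lnorm.
case: ifP => _; last exact: ltry.
apply: (@le_lt_trans _ _ C%:E); last exact: ltry.
apply/ess_supP; apply: nearW => x /=.
by rewrite lee_fin ger0_norm ?spinor_norm_ge0.
Qed.

(** The square decays with exponent 2 + 2 d, above the dimension. *)
Lemma in_L2_of_decay f (C d : R) : mx_measurable f -> 0 < d ->
  (forall x, spinor_norm (f x) <= C * japanese x `^ (- (1 + d))) ->
  in_Lp 2%:E f.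
Proof.
move=> mf d0 fC.
have d2 : 2 < 2 + 2 * d by lra.
have [A A0 hA] := @integral_japanese R (2 + 2 * d) d2.
apply: (in_L2_of_integral (N := C ^+ 2 * A) mf).
apply: (@le_trans _ _
  (\int[leb2]_y (C ^+ 2 * japanese y `^ (- (2 + 2 * d)))%:E)%E).
  apply: ge0_le_integral.
  - exact: measurableT.
  - by move=> x _; rewrite lee_fin sqr_ge0.
  - by apply/measurable_EFinP/measurable_funX/measurable_spinor_norm.
  - apply/measurable_EFinP; apply: measurable_funM; first exact: measurable_cst.
    exact: measurable_japanese_powR.
  move=> x _; rewrite lee_fin.
  have -> : japanese x `^ (- (2 + 2 * d)) = (japanese x `^ (- (1 + d))) ^+ 2.
    by rewrite expr2 powRD_gt0 ?japanese_gt0//; congr (_ `^ _); ring.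
  rewrite -exprMn; have := fC x; set w := _ `^ _ => fx.
  by rewrite ler_pXn2r ?nnegrE ?spinor_norm_ge0// (le_trans _ fx) ?spinor_norm_ge0.
apply: ge0_le_integralZ.
- exact: sqr_ge0.
- by move=> y; exact: powR_ge0.
- exact: measurable_japanese_powR.
- under eq_integral do rewrite -japanese0B; exact: hA.
Qed.

End Lp.

(** * Decay of the remainder *)
Section Remainder.
Context {R : realType}.
Implicit Types x y : plane R.

(** The first term is written with a scalar -1 so that the kernel is a linear
    combination of matrices like the second one. *)
Definition remainder_kernel x y : 'M[R[i]]_2 :=
  (- 1) *: G00_kernel x y + ('i / (2 * pi * japanese x ^+ 2)%:C) *: alpha_dot x.

Lemma remainder_kernelE x y : remainder_kernel x y =
  (((2 * pi)^-1)%:C * - 'i) *: alpha_dot (dipole_shift x y).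
Proof.
rewrite /remainder_kernel /G00_kernel !dipole_coefE !alpha_dotE.
apply/matrixP => i j; rewrite !mxE /dipole_shift.
set c := (2 * pi)^-1; set k := (_ ^+ 2)^-1; set l := (_ ^+ 2)^-1.
set z := x - y.
move: i; apply: ord2P => /=; move: j; apply: ord2P => /=; simpc => //.
- congr (_ +i* _); ring.
- congr (_ +i* _); ring.
Qed.

Lemma spinor_norm_remainder_kernel x y (a : 'cV[R[i]]_2) :
  spinor_norm (remainder_kernel x y *m a) <=
  (japanese x)^-1 * (japanese y * majorant (x - y)) * spinor_norm a.
Proof.
rewrite remainder_kernelE -scalemxAl spinor_normZ spinor_norm_alpha_dot.
have nc : ComplexField.Normc.normc (((2 * pi)^-1)%:C * - 'i : R[i]) <= 1.
  rewrite ComplexField.Normc.normcM normc_real normcN normc_i mulr1.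
  rewrite ger0_norm ?invr_ge0 ?(ltW twopi_gt0)//.
  by rewrite invf_le1 ?twopi_gt0// twopi_ge1.
apply: (@le_trans _ _ (enorm2 (dipole_shift x y) * spinor_norm a)).
  by rewrite ler_piMl// mulr_ge0 ?enorm2_ge0 ?spinor_norm_ge0.
by rewrite ler_wpM2r ?spinor_norm_ge0// dipole_shift_le.
Qed.

Definition remainder (h : spinor_field R) : spinor_field R := fun x =>
  - G00 h x + (('i / (2 * pi * japanese x ^+ 2)%:C) *: alpha_dot x)
                *m spinor_integral h.

Lemma measurable_remainder (h : spinor_field R) : mx_measurable h ->
  mx_measurable (remainder h).
Proof.
move=> mh; apply: mxmeasurableD.
  have -> : (fun x => - G00 h x) = (fun x => (- 1) *: G00 h x).
    by apply/funext => x; rewrite scaleN1r.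
  apply: mxmeasurableZ; first exact: cmeasurable_cst.
  exact: measurable_G00.
apply: mxmeasurableM; last exact: mxmeasurable_cst.
apply: mxmeasurable_dipole.
- by move=> x; exact: sqr_ge0.
- by apply: measurable_funX; exact: measurable_japanese.
- exact: measurable_id.
Qed.

(** The two terms of the remainder can be put under one integral only where both
    integrands are integrable; for the first this is finiteness of the
    potential at [x]. *)
Lemma remainderE (h : spinor_field R) x : spinor_integrable h ->
  (\int[leb2]_y ((enorm2 (x - y))^-1 * spinor_norm (h y))%:E < +oo)%E ->
  remainder h x = spinor_integral (fun y => remainder_kernel x y *m h y).
Proof.
move=> ih iP; have [mh hfin] := ih.
have iG : spinor_integrable (fun y => G00_kernel x y *m h y).
  split; first exact: mx_measurable_G00_integrand.
  exact: le_lt_trans (integral_G00_kernel_le _ mh) iP.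
rewrite /remainder; set D := (_ *: alpha_dot x).
have iD : spinor_integrable (fun y => D *m h y).
  have mD : mx_measurable (fun y => D *m h y).
    by apply: (mxmeasurableM _ mh); exact: mxmeasurable_cst.
  split => //.
  pose c := \sum_(i < 2) \sum_(j < 2) ComplexField.Normc.normc (D i j).
  have Dc i j : ComplexField.Normc.normc (D i j) <= c.
    rewrite /c; move: i; apply: ord2P; move: j; apply: ord2P; rewrite !big_ord2;
    by have := normc_ge0 (D 0 0); have := normc_ge0 (D 0 1);
       have := normc_ge0 (D 1 0); have := normc_ge0 (D 1 1); lra.
  have c0 : 0 <= c := le_trans (normc_ge0 _) (Dc 0 0).
  apply: (@le_lt_trans _ _ ((4 * c)%:E * \int[leb2]_y (spinor_norm (h y))%:E)%E).
    have mn := measurable_spinor_norm mh.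
    rewrite -ge0_integralZl_EFin//; last 3 first.
    - by move=> y _; rewrite lee_fin spinor_norm_ge0.
    - exact/measurable_EFinP.
    - by rewrite mulr_ge0.
    apply: ge0_le_integral => //.
    - by move=> y _; rewrite lee_fin spinor_norm_ge0.
    - exact/measurable_EFinP/measurable_spinor_norm.
    - by apply: measurable_funeM; exact/measurable_EFinP.
    - by move=> y _; rewrite -EFinM lee_fin spinor_norm_mulmx_le.
  by apply: lte_mul_pinfty; rewrite ?lee_fin ?mulr_ge0.
have m1 : (fun y => remainder_kernel x y *m h y) =
  (fun y => (-1)%:M *m (G00_kernel x y *m h y) + D *m h y).
  apply/funext => y; rewrite /remainder_kernel mulmxDl -scalemxAl.
  by rewrite mul_scalar_mx.
have iG' : spinor_integrable (fun y => (-1)%:M *m (G00_kernel x y *m h y)).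
  case: iG => mG fG; split.
    by apply: (mxmeasurableM _ mG); exact: mxmeasurable_cst.
  under eq_integral do
    rewrite mul_scalar_mx spinor_normZ normcN ComplexField.Normc.normc1 mul1r.
  exact: fG.
rewrite m1 spinor_integralD// !spinor_integral_mulmx//.
by rewrite mul_scalar_mx scaleN1r.
Qed.

(** The kernel difference costs a factor <y>, which the decay of [h] absorbs:
    1 - b <= - (1 + 2 d) for the chosen [d].  Capping [d] at 1 keeps the power
    <x - y>^(d - 1) from growing in [integral_majorant]. *)
Lemma remainder_decay (h : spinor_field R) (b K : R) : 2 < b -> 0 <= K ->
  spinor_integrable h ->
  (forall x,
    (\int[leb2]_y ((enorm2 (x - y))^-1 * spinor_norm (h y))%:E < +oo)%E) ->
  {ae leb2, forall y, spinor_norm (h y) <= K * japanese y `^ (- b)} ->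
  exists C d : R, [/\ 0 <= C, 0 < d &
    forall x, spinor_norm (remainder h x) <= C * japanese x `^ (- (1 + d))].
Proof.
move=> b2 K0 ih iP hK; have [mh _] := ih.
pose d := Num.min 1 ((b - 2) / 2).
have d0 : 0 < d by rewrite lt_min ltr01 divr_gt0 ?subr_gt0.
have d1 : d <= 1 by rewrite ge_min lexx.
have db : 2 * d <= b - 2.
  have : d <= (b - 2) / 2 by rewrite ge_min lexx orbT.
  lra.
have d01 : 0 < d <= 1 by rewrite d0.
have [A A0 hA] := integral_majorant d01.
exists (4 * (K * A)), d; split => //; first by rewrite !mulr_ge0.
move=> x; have X0 := japanese_gt0 x.
have Xi0 : 0 <= (japanese x)^-1 by rewrite invr_ge0 ltW.
have mE : mx_measurable (fun y => remainder_kernel x y *m h y).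
  apply: (mxmeasurableM (A := remainder_kernel x) _ mh).
  apply: mxmeasurableD; last exact: mxmeasurable_cst.
  apply: mxmeasurableZ; first exact: cmeasurable_cst.
  exact: mxmeasurable_G00_kernel.
have weight y :
    japanese y * japanese y `^ (- b) <= japanese y `^ (- (1 + 2 * d)).
  rewrite -[X in X * _](powRr1 (japanese_ge0 y)) powRD_gt0 ?japanese_gt0//.
  by apply: ler_powR; [exact: japanese_ge1|lra].
have w0 y : 0 <= japanese y `^ (- (1 + 2 * d)) * majorant (x - y).
  exact: mulr_ge0 (powR_ge0 _ _) (majorant_ge0 _).
have mw := @measurable_weight_majorant R (- (1 + 2 * d)) x.
have bound : (\int[leb2]_y (spinor_norm (remainder_kernel x y *m h y))%:E <=
    ((japanese x)^-1 * K * (A * japanese x `^ (- d)))%:E)%E.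
  apply: (@le_trans _ _ (\int[leb2]_y ((japanese x)^-1 * K *
      (japanese y `^ (- (1 + 2 * d)) * majorant (x - y)))%:E)%E).
    apply: ae_ge0_le_integral.
    - exact: measurableT.
    - by move=> y _; rewrite lee_fin spinor_norm_ge0.
    - by apply/measurable_EFinP/measurable_spinor_norm.
    - move=> y _; rewrite lee_fin; apply: mulr_ge0 (w0 y); exact: mulr_ge0.
    - apply/measurable_EFinP; exact: measurable_funM (measurable_cst _) mw.
    apply: filterS hK => y hy _; rewrite lee_fin.
    apply: le_trans (spinor_norm_remainder_kernel x y (h y)) _.
    rewrite -!mulrA; apply: (ler_wpM2l Xi0).
    have := ler_wpM2l (japanese_ge0 y) hy; move: (weight y) (majorant_ge0 (x - y)).
    move: (spinor_norm (h y)) (japanese y) (majorant (x - y))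
      (japanese y `^ (- b)) (japanese y `^ (- (1 + 2 * d))).
    move=> n Y m v w wl m0 hn.
    have : Y * n <= K * w.
      by apply: le_trans hn _; rewrite mulrCA; exact: ler_wpM2l.
    by move=> /(ler_wpM2r m0); congr (_ <= _); ring.
  apply: ge0_le_integralZ (hA x); [exact: mulr_ge0|exact: w0|exact: mw].
have := spinor_norm_integral_le mE; rewrite -remainderE//.
rewrite -lee_fin => /le_trans; apply.
apply: (@le_trans _ _
  (4%:E * ((japanese x)^-1 * K * (A * japanese x `^ (- d)))%:E)%E).
  by apply: lee_wpmul2l.
rewrite -EFinM lee_fin.
have -> : japanese x `^ (- (1 + d)) = (japanese x)^-1 * japanese x `^ (- d).
  by rewrite -(powR_inv1 (ltW X0)) powRD_gt0// opprD.
move: (japanese x)^-1 (_ `^ _) => i p; rewrite le_eqVlt; apply/orP; left.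
by apply/eqP; ring.
Qed.

End Remainder.

(** * The density v^* phi *)
Section Density.
Context {R : realType}.
Context (V B : matrix_field R) (zeta : 'I_2 -> plane R -> R).
Context (hdiag : diagonalizes V B zeta).

Lemma measurable_mult_adj_v (f : spinor_field R) : mx_measurable f ->
  mx_measurable (mult_adj (v_of B zeta) f).
Proof.
case: hdiag => mB mz _ _ mf.
apply: (mxmeasurableM (A := fun y => (v_of B zeta y)^t*) _ mf) => i j.
rewrite (_ : (fun t => _) =
    (fun t => Num.conj ((Num.sqrt `|zeta j t|)%:C * B t j i))); last first.
  by apply/funext => t; rewrite mxE mxE /v_of mul_diag_mx !mxE.
apply: cmeasurable_conj; apply: cmeasurableM; last exact: mB.
apply: cmeasurable_real; apply: measurable_sqrt_comp => //.
exact: measurableT_comp (mz j).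
Qed.

Lemma spinor_norm_mult_adj_v (f : spinor_field R) y (c : R) : 0 <= c ->
  (forall i j, ComplexField.Normc.normc (V y i j) <= c) ->
  spinor_norm (mult_adj (v_of B zeta) f y) <=
  4 * Num.sqrt (4 * c) * spinor_norm (f y).
Proof.
case: hdiag => _ _ Bu VE c0 hV.
have z4 := eigenvalue_le (Bu y) (VE y) c0 hV.
exact: (spinor_norm_mulmx_le (f y) (v_adj_entry_le (Bu y) z4)).
Qed.

(** Here |h| <= 4 s |f| with s^2 = 4 c <y>^(-beta).  For the first integral
    2 s |f| <= s^2 + |f|^2, and s^2 is integrable because beta > 2; for the
    second s is bounded. *)
Lemma density_integrals (f : spinor_field R) (beta c : R) :
  2 < beta -> 0 <= c ->
  (forall y i j,
    ComplexField.Normc.normc (V y i j) <= c * japanese y `^ (- beta)) ->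
  in_Lp 2%:E f ->
  exists H1 H2 : R,
    (\int[leb2]_y (spinor_norm (mult_adj (v_of B zeta) f y))%:E <= H1%:E)%E /\
    (\int[leb2]_y (spinor_norm (mult_adj (v_of B zeta) f y) ^+ 2)%:E <=
     H2%:E)%E.
Proof.
move=> b2 c0 hV f2; have [mf _] := f2; have mh := measurable_mult_adj_v mf.
have mhn := measurable_spinor_norm mh; have mfn := measurable_spinor_norm mf.
have [N N0 hN] := in_L2_integral f2; have [A A0 hA] := integral_japanese b2.
have w0 y : 0 <= japanese y `^ (- beta) by exact: powR_ge0.
have w1 y : japanese y `^ (- beta) <= 1.
  by apply: powR_le1; [exact: japanese_ge1|lra].
have cw0 y : 0 <= c * japanese y `^ (- beta) by exact: mulr_ge0.
have mw := @measurable_japanese_powR R (- beta).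
have hs y := spinor_norm_mult_adj_v f (cw0 y) (hV y).
have ss y : Num.sqrt (4 * (c * japanese y `^ (- beta))) ^+ 2 =
    4 * (c * japanese y `^ (- beta)).
  by rewrite sqr_sqrtr// mulr_ge0.
have hw : (\int[leb2]_y (japanese y `^ (- beta))%:E <= A%:E)%E.
  by under eq_integral do rewrite -japanese0B; exact: hA.
exists (8 * c * A + 2 * N), (64 * c * N); split.
  apply: (@le_trans _ _ (\int[leb2]_y
      (8 * c * japanese y `^ (- beta) + 2 * spinor_norm (f y) ^+ 2)%:E)%E).
    apply: ge0_le_integral.
    - exact: measurableT.
    - by move=> y _; rewrite lee_fin spinor_norm_ge0.
    - exact/measurable_EFinP.
    - apply/measurable_EFinP; apply: measurable_funD.
        exact: measurable_funM (measurable_cst _) mw.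
      by apply: measurable_funM (measurable_cst _) _; exact: measurable_funX.
    move=> y _; rewrite lee_fin; apply: le_trans (hs y) _.
    have := ss y.
    move: (japanese y `^ (- beta)) (spinor_norm (f y)) (Num.sqrt _) => w n s sE.
    have := sqr_ge0 (s - n); rewrite sqrrB sE; lra.
  apply: ge0_le_integralD.
  - by move=> y; rewrite !mulr_ge0.
  - by move=> y; rewrite mulr_ge0 ?sqr_ge0.
  - exact: measurable_funM (measurable_cst _) mw.
  - by apply: measurable_funM (measurable_cst _) _; exact: measurable_funX.
  - by apply: ge0_le_integralZ hw => //; rewrite mulr_ge0.
  - apply: ge0_le_integralZ hN => //; first by move=> y; exact: sqr_ge0.
    exact: measurable_funX.
apply: (@le_trans _ _ (\int[leb2]_y (64 * c * spinor_norm (f y) ^+ 2)%:E)%E).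
  apply: ge0_le_integral.
  - exact: measurableT.
  - by move=> y _; rewrite lee_fin sqr_ge0.
  - by apply/measurable_EFinP; exact: measurable_funX.
  - apply/measurable_EFinP; apply: measurable_funM (measurable_cst _) _.
    exact: measurable_funX.
  move=> y _; rewrite lee_fin.
  have h0 := spinor_norm_ge0 (mult_adj (v_of B zeta) f y).
  apply: (@le_trans _ _ ((4 * Num.sqrt (4 * (c * japanese y `^ (- beta))) *
      spinor_norm (f y)) ^+ 2)).
    by rewrite ler_pXn2r ?nnegrE// (le_trans h0).
  rewrite !exprMn ss; apply: (ler_wpM2r (sqr_ge0 _)).
  have := ler_wpM2l c0 (w1 y); rewrite -natrX; lra.
apply: ge0_le_integralZ hN.
- by rewrite mulr_ge0.
- by move=> y; exact: sqr_ge0.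
- exact: measurable_funX.
Qed.

(** T phi = 0 reads U phi = v psi, and U is its own inverse. *)
Lemma kernel_T_eq (phi psi : spinor_field R) :
  in_ker (T_of B zeta) phi ->
  (forall x, psi x = - G00 (mult_adj (v_of B zeta) phi) x) ->
  ae_same phi (mult (U_of zeta) (mult (v_of B zeta) psi)).
Proof.
move=> [_ T0] hpsi; apply: filterS T0 => x Tx _; have {}Tx := Tx I.
move: Tx; rewrite /T_of /mult => Tx.
have Uphi : U_of zeta x *m phi x = v_of B zeta x *m psi x.
  by rewrite hpsi mulmxN; apply/eqP; rewrite -subr_eq0 opprK Tx.
by rewrite -Uphi mulmxA U_ofK mul1mx.
Qed.

Lemma density_eq (phi psi : spinor_field R) x :
  phi x = mult (U_of zeta) (mult (v_of B zeta) psi) x ->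
  mult_adj (v_of B zeta) phi x = V x *m psi x.
Proof.
case: hdiag => _ _ Bu VE; rewrite /mult_adj /mult => ->.
have mulmxA4 (M N P : 'M[R[i]]_2) (a : 'cV[R[i]]_2) :
  M *m (N *m (P *m a)) = M *m N *m P *m a by rewrite !mulmxA.
by rewrite mulmxA4 (v_adj_U_v (VE x)).
Qed.

End Density.

Theorem lemma7p2 (R : realType) (beta : R) (hbeta : 2 < beta)
  (V B : matrix_field R) (zeta : 'I_2 -> plane R -> R)
  (hVmeas : mx_measurable V)
  (hVherm : forall x, V x \is hermsymmx)
  (hVdecay : decays beta V)
  (hdiag : diagonalizes V B zeta)
  (S1 : spinor_field R -> spinor_field R)
  (hS1 : is_Riesz_projection_onto_ker (T_of B zeta) S1)
  (phi : spinor_field R) (hphi : in_range S1 phi)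
  (psi : spinor_field R)
  (hpsi : forall x, psi x = - G00 (mult_adj (v_of B zeta) phi) x) :
  ae_same phi (mult (U_of zeta) (mult (v_of B zeta) psi)) /\
  exists Gamma2 : spinor_field R,
    [/\ in_Lp 2%:E Gamma2, in_Lp +oo%E Gamma2 &
        forall x, psi x =
          ((- 'i / (2 * pi * japanese x ^+ 2)%:C) *: alpha_dot x)
            *m G11 (mult_adj (v_of B zeta) phi) x + Gamma2 x].
Proof.
have kphi : in_ker (T_of B zeta) phi := (hS1.2 phi).1 hphi.
have phiE := kernel_T_eq kphi hpsi.
split=> //; have [[mphi phi2] _] := kphi.
set h := mult_adj (v_of B zeta) phi in hpsi *.
have [c hc] := hVdecay.
have c0 : 0 <= c.
  have := le_trans (normc_ge0 _) (hc 0 0 0).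
  by rewrite pmulr_lge0// powR_gt0// japanese_gt0.
have mh : mx_measurable h by exact: measurable_mult_adj_v hdiag _ mphi.
have [H1 [H2 [hH1 hH2]]] :=
  density_integrals hdiag hbeta c0 hc (conj mphi phi2).
have ih : spinor_integrable h by split => //; exact: le_lt_trans hH1 (ltry _).
have w1 y : japanese y `^ (- beta) <= 1.
  by apply: powR_le1; [exact: japanese_ge1|lra].
have hpot : {ae leb2, forall y, spinor_norm (h y) <=
    4 * (c * japanese y `^ (- beta)) * spinor_norm (psi y)}.
  apply: filterS phiE => y /(_ I) /(density_eq hdiag) hy.
  by rewrite /h hy; apply: spinor_norm_mulmx_le => i j; exact: hc.
have psi_le y : spinor_norm (psi y) = spinor_norm (G00 h y).
  by rewrite hpsi -scaleN1r spinor_normZ normcN ComplexField.Normc.normc1 mul1r.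
(* One factor 4 comes from the matrix V, the other from the integral. *)
have [||||||M hM] :=
  @potential_bounded R (fun y => spinor_norm (h y)) (16 * c) H1 H2.
- by rewrite mulr_ge0.
- by move=> y; exact: spinor_norm_ge0.
- exact: measurable_spinor_norm.
- exact: hH1.
- exact: hH2.
- apply: filterS hpot => y hy.
  have step : spinor_norm (h y) <= 4 * c * spinor_norm (G00 h y).
    rewrite -psi_le; apply: le_trans hy _.
    apply: (ler_wpM2r (spinor_norm_ge0 _)).
    by rewrite mulrA; apply: ler_piMr; rewrite ?mulr_ge0// w1.
  apply: (@le_trans _ _ ((4 * c)%:E * (spinor_norm (G00 h y))%:E)%E).
    by rewrite -EFinM lee_fin.
  have -> : (16 * c)%:E = ((4 * c)%:E * 4%:E)%E.
    by rewrite -EFinM; congr EFin; ring.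
  rewrite -muleA; apply: lee_wpmul2l; last exact: spinor_norm_G00_le.
  by rewrite lee_fin mulr_ge0.
have psiM y : spinor_norm (psi y) <= 4 * M.
  rewrite psi_le -lee_fin EFinM; apply: le_trans (spinor_norm_G00_le y mh) _.
  by apply: lee_wpmul2l; rewrite ?lee_fin//; exact: hM.
have M0 : 0 <= M.
  rewrite -lee_fin; apply: le_trans (hM 0); apply: integral_ge0 => y _.
  by rewrite lee_fin mulr_ge0 ?invr_ge0 ?enorm2_ge0 ?spinor_norm_ge0.
have hdens : {ae leb2, forall y,
    spinor_norm (h y) <= 16 * c * M * japanese y `^ (- beta)}.
  apply: filterS hpot => y hy; apply: le_trans hy _.
  have cw0 : 0 <= 4 * (c * japanese y `^ (- beta)).
    by rewrite mulr_ge0// mulr_ge0// powR_ge0.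
  have := ler_wpM2l cw0 (psiM y); congr (_ <= _); ring.
have [C [d [C0 d0 hG]]] := @remainder_decay R h beta (16 * c * M) hbeta
   (mulr_ge0 (mulr_ge0 (ler0n _ _) c0) M0) ih
   (fun x => le_lt_trans (hM x) (ltry _)) hdens.
have mG := measurable_remainder mh.
exists (remainder h); split.
- exact: in_L2_of_decay mG d0 hG.
- apply: (in_Loo_of_bounded (C := C) mG) => x; apply: le_trans (hG x) _.
  rewrite ler_piMr// powR_le1 ?japanese_ge1//; lra.
move=> x; rewrite /remainder hpsi.
have -> : G11 h x = spinor_integral h.
  by congr spinor_integral; apply/funext => y; rewrite mul1mx.
by rewrite mulNr scaleNr mulNmx addrCA addNr addr0.
Qed.
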